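(* Let $x_0\in\mathbb{R}^p$, let $J:\mathbb{R}^p\to[0,+\infty)$ be a finite-valued convex function, and let $\mathcal{M}\subset\mathbb{R}^p$ be a set containing $x_0$ such that $J$ is locally partly smooth at $x_0$ relative to $\mathcal{M}$. Write $T=T_{x_0}$. Assume that there exists $\tilde\Gamma\in\mathbb{R}^{p\times p}$ such that $$\ker(\tilde\Gamma)\cap T=\{0\}\quad\text{and}\quad \eta_{\tilde\Gamma}\in\mathrm{ri}(\partial J(x_0)).$$ Then there exists a constant $C>0$ such that, for every canonical parameter $\theta=(\mu,u,\Gamma)$ with $\mu>0$ and with $\varepsilon=u-\Gamma x_0$, if $$\max\left(\|\Gamma-\tilde\Gamma\|,\ \|\varepsilon\|\mu^{-1},\ \mu\right)\le C,$$ then for every starting point $x^{(0)}\in\mathbb{R}^p$ and every step size $0<\tau<2/\|\Gamma\|$, the Forward-Backward iterates $$x^{(k+1)}=\mathrm{Prox}_{\tau\mu J}\left(x^{(k)}+\tau(u-\Gamma x^{(k)})\right),\qquad k\ge0,$$ satisfy $x^{(k)}\in\mathcal{M}$ for all $k$ large enough.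
   Context: Observation model and canonical parameters: $y=\Phi x_0+w$ with $\Phi\in\mathbb{R}^{n\times p}$ (for some $n\ge1$), $w\in\mathbb{R}^n$, and $\lambda>0$ a regularization parameter. The canonical parameters are $\theta=(\mu,u,\Gamma)=\left(\frac{\lambda}{n},\frac{\Phi^*y}{n},\frac{\Phi^*\Phi}{n}\right)$ and $\varepsilon=\frac{\Phi^*w}{n}=u-\Gamma x_0$. In particular $\Gamma$ is symmetric positive semidefinite and $u\in\mathrm{Im}(\Gamma)$. The Forward-Backward iteration is a scheme for solving $(\mathcal{P}_\theta)$: $\min_{x\in\mathbb{R}^p}J(x)+\frac{1}{2\mu}\langle\Gamma x,x\rangle-\frac1\mu\langle x,u\rangle+\frac{1}{2\mu}\langle\Gamma^+u,u\rangle$, where $A^+$ is the Moore–Penrose pseudo-inverse of $A$. For $\gamma>0$, $\mathrm{Prox}_{\gamma J}(x)=\mathrm{argmin}_{x'\in\mathbb{R}^p}\frac12\|x-x'\|^2+\gamma J(x')$. $\|\Gamma\|$ is the operator norm (with $2/\|\Gamma\|=+\infty$ if $\Gamma=0$). Notation: $\partial J$ is the convex subdifferential; $\mathrm{ri}$ is the relative interior. For a convex set $\mathcal{C}$, $\mathrm{VecHull}(\mathcal{C})=\{\rho(x-x'):(x,x')\in\mathcal{C}^2,\rho\in\mathbb{R}\}$ and its linear span is the subspace parallel to the affine hull of $\mathcal{C}$. The tangent model subspace at $x$ is $T_x=\mathrm{VecHull}(\partial J(x))^\perp$. $P_T$ is the orthogonal projection onto a subspace $T$, and $\Gamma_T=P_T\Gamma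 P_T$. With $T=T_{x_0}$, the vector $e=P_T(\partial J(x_0))$ is well defined (the projection onto $T$ of any element of $\partial J(x_0)$). For a matrix $\tilde\Gamma$ with $\ker(\tilde\Gamma)\cap T=\{0\}$, the linearized pre-certificate is $\eta_{\tilde\Gamma}=\tilde\Gamma\,\tilde\Gamma_T^+e$. Partial smoothness: a finite-valued convex function $J$ is partly smooth at $x$ relative to a set $\mathcal{M}$ containing $x$ if (i) $\mathcal{M}$ is a $C^2$-manifold (embedded in $\mathbb{R}^p$) around $x$ and $J$ restricted to $\mathcal{M}$ is $C^2$ around $x$; (ii) the tangent space of $\mathcal{M}$ at $x$ is $T_x$; (iii) the set-valued mapping $\partial J$ is continuous at $x$ relative to $\mathcal{M}$ (equivalently, since $J$ is finite convex: for any sequence $x_n\in\mathcal{M}$ with $x_n\to x$ and any $\eta\in\partial J(x)$, there exist $\eta_n\in\partial J(x_n)$ with $\eta_n\to\eta$). $J$ is locally partly smooth at $x$ relative to $\mathcal{M}$ if $\mathcal{M}$ is a manifold and there is a neighbourhood $U$ of $x$ such that $J$ is partly smooth at every $x'\in\mathcal{M}\cap U$ relative to $\mathcal{M}$. *)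

(* Defs.v *)
From HB Require Import structures.
From mathcomp Require Import all_boot all_order all_algebra.
From mathcomp Require Import all_classical all_reals all_analysis.

Set Implicit Arguments.
Unset Strict Implicit.
Unset Printing Implicit Defensive.

Import Order.TTheory GRing.Theory Num.Theory.
Import numFieldNormedType.Exports.

Local Open Scope classical_set_scope.
Local Open Scope ring_scope.

(* The library norm on matrices is the sup norm. It is used below only through
   the topology it induces; all metric quantities use [enorm] and [opnorm]. *)

Section Euclidean.
Variables (R : realType) (p : nat).
Implicit Types (u v x y : 'cV[R]_p) (A P : 'M[R]_p) (C T : set 'cV[R]_p).

Definition dot u v : R := \sum_i u i ord0 * v i ord0.

Definition enorm v : R := Num.sqrt (dot v v).

Definition opnorm A : R :=
  sup [set enorm (A *m v) | v in [set v | enorm v <= 1]].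

Definition orth C : set 'cV[R]_p := [set v | forall c, C c -> dot v c = 0].

Definition affine_hull C : set 'cV[R]_p :=
  [set z | exists (m : nat) (a : 'I_m -> R) (c : 'I_m -> 'cV[R]_p),
    [/\ forall i, C (c i), \sum_i a i = 1 & z = \sum_i a i *: c i]].

Definition ri C : set 'cV[R]_p :=
  [set x | C x /\ \forall y \near x, affine_hull C y -> C y].

Definition vec_hull C : set 'cV[R]_p :=
  [set v | exists x y (rho : R), [/\ C x, C y & v = rho *: (x - y)]].

(* [T] is meant to be a linear subspace, in which case exactly one matrix
   satisfies this condition. *)
Definition is_orth_proj T P : Prop :=
  forall v, T (P *m v) /\ orth T (v - P *m v).

Definition orth_proj T : 'M[R]_p := xget 0 (is_orth_proj T).

(* The four Penrose conditions, which have exactly one solution. *)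
Definition is_pinv A P : Prop :=
  [/\ A *m P *m A = A, P *m A *m P = P,
      (A *m P)^T = A *m P & (P *m A)^T = P *m A].

Definition pinv A : 'M[R]_p := xget 0 (is_pinv A).

Definition argmin (f : 'cV[R]_p -> R) : set 'cV[R]_p :=
  [set z | forall y, f z <= f y].

End Euclidean.

Section Smooth.
Variable R : realType.

(* In finite dimension, continuity of the differential amounts to continuity of
   [fun x => 'd f x v] for each [v]. *)
Fixpoint Ck (V W : normedModType R) (k : nat) (U : set V) (f : V -> W) : Prop :=
  if k is k'.+1 then
    (forall x, U x -> differentiable f x) /\
    (forall v, Ck k' U (fun x => 'd f x v))
  else forall x, U x -> {for x, continuous f}.

Variable p : nat.
Implicit Types (M U T : set 'cV[R]_p) (x : 'cV[R]_p) (J : 'cV[R]_p -> R).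

Definition local_equation M x m (G : 'cV[R]_p -> 'cV[R]_m) U : Prop :=
  [/\ open U, U x, Ck 2 U G,
      (forall w, exists v, 'd G x v = w) &
      M `&` U = [set y | G y = 0] `&` U].

Definition C2_manifold_at M x : Prop :=
  exists m (G : 'cV[R]_p -> 'cV[R]_m) U, local_equation M x G U.

Definition C2_manifold M : Prop := forall x, M x -> C2_manifold_at M x.

(* The kernel does not depend on the choice of the local equation. *)
Definition is_tangent_space M x T : Prop :=
  exists m (G : 'cV[R]_p -> 'cV[R]_m) U,
    local_equation M x G U /\ T = [set v | 'd G x v = 0].

Definition C2_restricted_at J M x : Prop :=
  exists (h : 'cV[R]_p -> R) U,
    [/\ open U, U x, Ck 2 U (h : 'cV[R]_p -> R^o) &
        forall y, M y -> U y -> J y = h y].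

End Smooth.

Section PartlySmooth.
Variables (R : realType) (p : nat).
Implicit Types (M : set 'cV[R]_p) (x : 'cV[R]_p) (J : 'cV[R]_p -> R).

Definition subdiff J x : set 'cV[R]_p :=
  [set eta | forall y, J x + dot eta (y - x) <= J y].

Definition model_space J x : set 'cV[R]_p := orth (vec_hull (subdiff J x)).

(* Painleve-Kuratowski continuity: inner and outer semicontinuity. The outer
   part holds automatically when [J] is finite and convex. *)
Definition subdiff_continuous_at J M x : Prop :=
  forall z : nat -> 'cV[R]_p, (forall n, M (z n)) -> z @ \oo --> x ->
    (forall eta, subdiff J x eta ->
       exists2 etan : nat -> 'cV[R]_p,
         (forall n, subdiff J (z n) (etan n)) & etan @ \oo --> eta) /\
    (forall (etan : nat -> 'cV[R]_p) eta,
       (forall n, subdiff J (z n) (etan n)) -> etan @ \oo --> eta ->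
       subdiff J x eta).

Definition partly_smooth J M x : Prop :=
  [/\ M x, C2_manifold_at M x, C2_restricted_at J M x,
      is_tangent_space M x (model_space J x) & subdiff_continuous_at J M x].

Definition locally_partly_smooth J M x : Prop :=
  C2_manifold M /\
  exists2 U, nbhs x U & forall y, M y -> U y -> partly_smooth J M y.

(* The set below is a singleton when [J] is finite and convex. *)
Definition model_vector J x : 'cV[R]_p :=
  xget 0 [set orth_proj (model_space J x) *m eta | eta in subdiff J x].

Definition precertificate J x (Gt : 'M[R]_p) : 'cV[R]_p :=
  let P := orth_proj (model_space J x) in
  Gt *m pinv (P *m Gt *m P) *m model_vector J x.

End PartlySmooth.

Section ForwardBackward.
Variables (R : realType) (p : nat).
Implicit Types (x u : 'cV[R]_p) (J : 'cV[R]_p -> R) (Gamma : 'M[R]_p).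

(* The parameters generated by an observation [Phi *m x0 + w]. *)
Definition canonical_parameter x0 (mu : R) u Gamma : Prop :=
  exists (n : nat) (Phi : 'M[R]_(n, p)) (w : 'cV[R]_n) (lambda : R),
    [/\ (0 < n)%N /\ 0 < lambda,
        mu = lambda / n%:R,
        u = n%:R^-1 *: (Phi^T *m (Phi *m x0 + w)) &
        Gamma = n%:R^-1 *: (Phi^T *m Phi)].

Definition prox (gamma : R) J x : 'cV[R]_p :=
  xget 0 (argmin (fun y => 2^-1 * enorm (x - y) ^+ 2 + gamma * J y)).

Definition FB_step J (mu : R) u Gamma (tau : R) x : 'cV[R]_p :=
  prox (tau * mu) J (x + tau *: (u - Gamma *m x)).

End ForwardBackward.

(* Main.v *)
(* Let T be the model space at x0, P the orthogonal projection onto T, and write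
   eta = Gt q for the pre-certificate, with q in T.

   Identification: if g in dJ(z) with (z, g) close to (x0, eta), then z lies in M.
   Otherwise z - y is normal to M for some nearby y in M; testing monotonicity of
   the subdifferential against subgradients at y that approximate eta + c n, where
   n is a limit normal direction, contradicts eta in ri dJ(x0).

   Localisation: since eta + c n is a subgradient at x0 for every unit n orthogonal
   to T, a critical point x0 + v for (mu, u, Gamma) satisfies
     <Gamma v, v> + mu <eta, v> + mu c |v - P v| <= <eps, v>,
   and the injectivity of Gt on T turns this into |v| = O(mu). A limit s of v / mu
   has - Gt s in dJ(x0) and <- Gt s - eta, s> >= 0, whence <Gt (s + q), s + q> <= 0
   and - Gt s = eta. So every critical point is close to x0 and its subgradient
   (u - Gamma x) / mu is close to eta.

   Forward-Backward: Fejer monotonicity makes the iterates bounded, x_k - x_{k+1}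
   and Gamma (x_k - z) vanish for a minimiser z, so all cluster points are critical
   and the subgradients produced by the proximal steps converge; identification
   applies to the tail. *)
Require Import Defs.
From mathcomp Require Import all_boot all_order all_algebra.
From mathcomp Require Import all_classical all_reals all_analysis.
From mathcomp Require Import ring lra.
Import Order.TTheory GRing.Theory Num.Theory.
Import numFieldNormedType.Exports.
Local Open Scope classical_set_scope.
Local Open Scope ring_scope.

Set Implicit Arguments.
Unset Strict Implicit.
Unset Printing Implicit Defensive.

(** * Euclidean inner product, semidefinite matrices and the operator norm *)

Section Euclidean.
Variables (R : realType) (p : nat).
Implicit Types (u v w x y : 'cV[R]_p) (A : 'M[R]_p).

Lemma dotE u v : dot u v = (u^T *m v) ord0 ord0.
Proof. by rewrite mxE; apply: eq_bigr => i _; rewrite mxE. Qed.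

Lemma dotC u v : dot u v = dot v u.
Proof. by apply: eq_bigr => i _; rewrite mulrC. Qed.

Lemma dotDl u v w : dot (u + v) w = dot u w + dot v w.
Proof. by rewrite !dotE linearD mulmxDl mxE. Qed.

Lemma dotDr u v w : dot u (v + w) = dot u v + dot u w.
Proof. by rewrite !dotE mulmxDr mxE. Qed.

Lemma dotZl a u v : dot (a *: u) v = a * dot u v.
Proof. by rewrite !dotE linearZ -scalemxAl mxE. Qed.

Lemma dotZr a u v : dot u (a *: v) = a * dot u v.
Proof. by rewrite dotC dotZl dotC. Qed.

Lemma dotNl u v : dot (- u) v = - dot u v.
Proof. by rewrite -scaleN1r dotZl mulN1r. Qed.

Lemma dotNr u v : dot u (- v) = - dot u v.
Proof. by rewrite dotC dotNl dotC. Qed.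

Lemma dotBl u v w : dot (u - v) w = dot u w - dot v w.
Proof. by rewrite dotDl dotNl. Qed.

Lemma dotBr u v w : dot u (v - w) = dot u v - dot u w.
Proof. by rewrite dotDr dotNr. Qed.

Definition dotlin := (dotDl, dotDr, dotBl, dotBr, dotNl, dotNr, dotZl, dotZr).

Lemma dot0l v : dot 0 v = 0.
Proof. by rewrite -(scale0r 0) dotZl mul0r. Qed.

Lemma dot_ge0 v : 0 <= dot v v.
Proof. by apply: sumr_ge0 => i _; rewrite -expr2 sqr_ge0. Qed.

Lemma enorm_ge0 v : 0 <= enorm v.
Proof. exact: sqrtr_ge0. Qed.

Lemma sqr_enorm v : enorm v ^+ 2 = dot v v.
Proof. by rewrite sqr_sqrtr ?dot_ge0. Qed.

Lemma enorm0 : enorm (0 : 'cV[R]_p) = 0.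
Proof. by rewrite /enorm dot0l sqrtr0. Qed.

Lemma enormZ a v : enorm (a *: v) = `|a| * enorm v.
Proof.
by rewrite /enorm dotZl dotZr mulrA -expr2 sqrtrM ?sqr_ge0// sqrtr_sqr.
Qed.

Lemma enormN v : enorm (- v) = enorm v.
Proof. by rewrite -scaleN1r enormZ normrN1 mul1r. Qed.

Lemma enormBC u v : enorm (u - v) = enorm (v - u).
Proof. by rewrite -opprB enormN. Qed.

Lemma coord_le_enorm v i : `|v i ord0| <= enorm v.
Proof.
rewrite -sqrtr_sqr ler_sqrt ?dot_ge0// /dot (bigD1 i)//= -expr2 lerDl.
by apply: sumr_ge0 => j _; rewrite -expr2 sqr_ge0.
Qed.

Lemma enorm_eq0 v : enorm v = 0 -> v = 0.
Proof.
move=> v0; apply/colP => i; rewrite [RHS]mxE; apply/eqP.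
by rewrite -normr_le0 -v0 coord_le_enorm.
Qed.

Lemma enorm_gt0 v : v != 0 -> 0 < enorm v.
Proof.
move=> v0; rewrite lt_neqAle enorm_ge0 andbT eq_sym.
by apply: contra v0 => /eqP/enorm_eq0 ->.
Qed.

(** For [c > 0], evaluate at the vertex [- b / c]. The case [c = 0] matters because semidefinite
    forms may degenerate; there a nonzero [b] would let the affine function reach [-1]. *)
Lemma discriminant_le (a b c : R) : 0 <= c ->
  (forall t, 0 <= a + 2 * b * t + c * t ^+ 2) -> b ^+ 2 <= a * c.
Proof.
rewrite le_eqVlt => /predU1P[<-|c0] h.
  have [->|b0] := eqVneq b 0; first by rewrite expr0n mulr0.
  have := h (- (a + 1) / (2 * b)).
  have -> : a + 2 * b * (- (a + 1) / (2 * b)) + 0 * (- (a + 1) / (2 * b)) ^+ 2 = -1.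
    by field.
  by rewrite ler0N1.
have := h (- b / c).
have -> : a + 2 * b * (- b / c) + c * (- b / c) ^+ 2 = (a * c - b ^+ 2) / c.
  by field; rewrite gt_eqF.
by rewrite pmulr_lge0 ?invr_gt0// subr_ge0.
Qed.

Definition psd A := A^T = A /\ forall v, 0 <= dot (A *m v) v.

Lemma dot_mulmxl A u v : dot (A *m u) v = dot u (A^T *m v).
Proof. by rewrite !dotE trmx_mul mulmxA. Qed.

Lemma psd_dotC A u v : psd A -> dot (A *m u) v = dot (A *m v) u.
Proof. by case=> As _; rewrite dot_mulmxl As dotC. Qed.

Lemma psd_cauchy_schwarz A u v : psd A ->
  dot (A *m u) v ^+ 2 <= dot (A *m u) u * dot (A *m v) v.
Proof.
move=> Apsd; have [_ A0] := Apsd; apply: discriminant_le => // t.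
have := A0 (u + t *: v).
rewrite mulmxDr -scalemxAr !dotlin (psd_dotC v u)//.
by congr (_ <= _); ring.
Qed.

(** Cauchy-Schwarz for the form of [A], applied to [v] and [A *m v], bounds the fourth power of
    [enorm (A *m v)] by a nonpositive product. *)
Lemma psd_eq0 A v : psd A -> dot (A *m v) v <= 0 -> A *m v = 0.
Proof.
move=> Apsd h; have [_ A0] := Apsd; apply: enorm_eq0.
apply/eqP; rewrite -sqrf_eq0 sqr_enorm -sqrf_eq0 eq_le sqr_ge0 andbT.
apply: le_trans (psd_cauchy_schwarz v (A *m v) Apsd) _.
by rewrite mulr_le0_ge0.
Qed.

Lemma psd1 : psd 1%:M.
Proof. by split=> [|v]; [rewrite trmx1 | rewrite mul1mx dot_ge0]. Qed.

Lemma cauchy_schwarz u v : `|dot u v| <= enorm u * enorm v.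
Proof.
rewrite -(@ler_pXn2r _ 2%N) ?nnegrE ?mulr_ge0 ?enorm_ge0//.
rewrite real_normK ?num_real// exprMn.
by have := psd_cauchy_schwarz u v psd1; rewrite !mul1mx -!sqr_enorm.
Qed.

Lemma dot_le u v : dot u v <= enorm u * enorm v.
Proof. exact: le_trans (ler_norm _) (cauchy_schwarz _ _). Qed.

Lemma dot_ge u v : - (enorm u * enorm v) <= dot u v.
Proof. by rewrite lerNl -dotNl -(enormN u) dot_le. Qed.

Lemma enormD u v : enorm (u + v) <= enorm u + enorm v.
Proof.
rewrite -(@ler_pXn2r _ 2%N) ?nnegrE ?addr_ge0 ?enorm_ge0// sqrrD !sqr_enorm.
by have := dot_le u v; rewrite !dotlin (dotC v u); lra.
Qed.

Lemma enormB u v : enorm (u - v) <= enorm u + enorm v.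
Proof. by rewrite (le_trans (enormD _ _))// enormN. Qed.

(** The constant is the Frobenius norm, plus 1 to stay positive when [A = 0]. For square [A] it
    shows that the set in [opnorm] is bounded, so that its [sup] is a genuine one. *)
Lemma mulmx_enorm_bounded (q : nat) (A : 'M[R]_(q, p)) :
  exists2 K, 0 < K & forall v, enorm (A *m v) <= K * enorm v.
Proof.
pose s := \sum_i enorm (row i A)^T ^+ 2.
have s0 : 0 <= s by apply: sumr_ge0 => i _; rewrite sqr_ge0.
exists (Num.sqrt s + 1) => [|v]; first by rewrite ltr_wpDl ?sqrtr_ge0.
apply: (@le_trans _ _ (Num.sqrt s * enorm v)); last first.
  by rewrite ler_wpM2r ?enorm_ge0// lerDl.
rewrite -sqrtrM// ler_sqrt ?mulr_ge0 ?dot_ge0// /dot [leRHS]mulr_suml.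
apply: ler_sum => i _; rewrite -expr2 -[X in _ * X]/(dot v v) -(sqr_enorm v).
have -> : (A *m v) i ord0 = dot (row i A)^T v.
  by rewrite !mxE; apply: eq_bigr => j _; rewrite !mxE.
rewrite -exprMn -real_normK ?num_real// ler_pXn2r ?nnegrE ?mulr_ge0 ?enorm_ge0//.
exact: cauchy_schwarz.
Qed.

Lemma opnorm_le A v : enorm (A *m v) <= opnorm A * enorm v.
Proof.
have [K K0 AK] := mulmx_enorm_bounded A.
have [->|v0] := eqVneq v 0; first by rewrite mulmx0 enorm0 mulr0.
have nv := enorm_gt0 v0.
rewrite -ler_pdivrMr// mulrC -[X in X * _ <= _]gtr0_norm ?invr_gt0//.
rewrite -enormZ scalemxAr; apply: ub_le_sup.
  exists K => _ [w /= w1 <-]; apply: le_trans (AK w) _.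
  by rewrite -[leRHS]mulr1 ler_pM2l.
exists ((enorm v)^-1 *: v) => //=.
by rewrite enormZ gtr0_norm ?invr_gt0// mulVf ?gt_eqF.
Qed.

Lemma opnorm_ge0 A : 0 <= opnorm A.
Proof.
have [K K0 AK] := mulmx_enorm_bounded A.
rewrite -enorm0 -(mulmx0 _ A); apply: ub_le_sup.
  exists K => _ [w /= w1 <-]; apply: le_trans (AK w) _.
  by rewrite -[leRHS]mulr1 ler_pM2l.
by exists 0 => //=; rewrite enorm0.
Qed.

(** Cocoercivity of [A]: Cauchy-Schwarz between [v] and [A *m v], divided by the squared norm of
    [A *m v]. The step size limit [2 / opnorm A] comes from this inequality. *)
Lemma psd_sqr_le A v : psd A -> enorm (A *m v) ^+ 2 <= opnorm A * dot (A *m v) v.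
Proof.
move=> Apsd; have [_ A0] := Apsd.
have [Av0|Av0] := eqVneq (A *m v) 0; first by rewrite Av0 enorm0 dot0l mulr0 expr0n.
have nv := enorm_gt0 Av0.
rewrite -(ler_pM2r (exprn_gt0 2 nv)) {1 2}sqr_enorm -expr2.
apply: le_trans (psd_cauchy_schwarz v (A *m v) Apsd) _.
rewrite -mulrA mulrCA ler_wpM2l//.
apply: le_trans (dot_le _ _) _.
by rewrite expr2 mulrA ler_wpM2r ?enorm_ge0 ?opnorm_le.
Qed.

End Euclidean.

(** * Convergence in the Euclidean norm, and compactness through ultrafilters *)

Section Topology.
Variables (R : realType) (p : nat).
Implicit Types (u v w x y : 'cV[R]_p) (A : 'M[R]_p).

Section Filter.
Context (I : Type) (F : set_system I) {FF : Filter F}.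
Implicit Types (f g : I -> 'cV[R]_p) (a b l : 'cV[R]_p).

Lemma cvg_coord f l : (forall i, (f k i ord0 @[k --> F] --> l i ord0)) ->
  f @ F --> l.
Proof.
move=> fl; apply/cvg_ballP => e e0.
have : \forall k \near F, forall i, ball (l i ord0) e (f k i ord0).
  apply: filter_forall => i; move/cvg_ballP: (fl i); exact.
by apply: filterS => k h; split => // i j; rewrite (ord1 j).
Qed.

Lemma cvg_coordE f l i : f @ F --> l -> f k i ord0 @[k --> F] --> l i ord0.
Proof.
move=> fl; apply: (@cvg_comp _ _ _ f (fun v : 'cV[R]_p => v i ord0) _ _ _ fl).
exact: coord_continuous.
Qed.

Lemma cvg_dot f g a b : f @ F --> a -> g @ F --> b ->
  dot (f k) (g k) @[k --> F] --> dot a b.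
Proof.
move=> fa gb; apply: cvg_big => [|i _]; first exact: add_continuous.
by apply: cvgM; apply: cvg_coordE.
Qed.

Lemma cvg_enorm f a : f @ F --> a -> enorm (f k) @[k --> F] --> enorm a.
Proof.
move=> fa; apply: (@cvg_comp _ _ _ _ (@Num.sqrt R)); first exact: (cvg_dot fa fa).
exact: sqrt_continuous.
Qed.

Lemma cvg_enorm_dist f a : f @ F --> a <-> enorm (f k - a) @[k --> F] --> 0.
Proof.
split=> [fa|fa].
  by rewrite -(enorm0 R p) -(subrr a); apply: cvg_enorm; apply: cvgB fa (cvg_cst a).
apply: cvg_coord => i; apply/cvgrPdist_le => e e0.
move/cvgrPdist_le: fa => /(_ _ e0); apply: filterS => k /=.
rewrite sub0r normrN ger0_norm ?enorm_ge0// => h.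
by rewrite distrC (le_trans _ h)// (le_trans _ (coord_le_enorm _ i))// !mxE.
Qed.

End Filter.

(** Neighbourhoods are those of the sup norm. One direction holds because [enorm] dominates each
    coordinate, the other because [enorm] is continuous. *)
Lemma nbhs_enormP x (P : set 'cV[R]_p) :
  nbhs x P <-> exists2 e, 0 < e & forall y, enorm (y - x) < e -> P y.
Proof.
split=> [|[e e0 eP]].
  move=> /nbhs_ballP[e e0 eP]; exists e => // y yx; apply: eP; split => // i j.
  rewrite (ord1 j) /ball/= distrC (le_lt_trans _ yx)//.
  by rewrite (le_trans _ (coord_le_enorm _ i))// !mxE.
have : enorm (y - x) @[y --> x] --> 0.
  exact: (cvg_enorm_dist (F := nbhs x) id x).1.
move/cvgrPdist_lt => /(_ _ e0); apply: filterS => y /=.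
by rewrite sub0r normrN ger0_norm ?enorm_ge0// => /eP.
Qed.

(** Along an ultrafilter a cluster point is a limit, since the preimage of a neighbourhood or of its
    complement belongs to [U]. This replaces the extraction of subsequences from here on. *)
Lemma ultra_cvg (T : topologicalType) (I : Type) (U : set_system I) (f : I -> T)
    (A : set T) : UltraFilter U -> compact A -> U (f @^-1` A) ->
  exists2 l, A l & f @ U --> l.
Proof.
move=> UU cA UA; have [l [Al cl]] := cA _ (fmap_proper_filter f (@ultra_proper _ _ UU)) UA.
exists l => // N Nl; have [//|UN] := in_ultra_setVsetC (f @^-1` N) UU.
by have [t [/= ]] := cl (~` N) N UN Nl.
Qed.

Lemma compact_enorm_ball x r : compact [set v | enorm (v - x) <= r].
Proof.
rewrite compact_ultra => F UF FA; have FF := @ultra_proper _ _ UF.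
have cvi i : exists l : R, v i ord0 @[v --> F] --> l.
  have [|l _ ?] := ultra_cvg (f := fun v : 'cV[R]_p => v i ord0) UF
    (@segment_compact R (x i ord0 - r) (x i ord0 + r)); last by exists l.
  apply: filterS FA => v /= vr; rewrite in_itv/= -ler_distl.
  by rewrite (le_trans _ vr)// (le_trans _ (coord_le_enorm _ i))// !mxE.
have [l lP] := choice cvi.
have Fl : id @ F --> (\col_i l i : 'cV[R]_p).
  by apply: cvg_coord => i; rewrite mxE; exact: lP.
exists (\col_i l i); split; last exact: Fl.
have : enorm (v - x) @[v --> F] --> enorm (\col_i l i - x).
  by apply: cvg_enorm; apply: cvgB Fl (cvg_cst x).
by move=> h; apply: (closed_cvg _ (@closed_le R r) _ _ h).
Qed.

Lemma bounded_ultra_cvg (I : Type) (U : set_system I) (f : I -> 'cV[R]_p) r :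
  UltraFilter U -> U [set k | enorm (f k) <= r] -> exists l : 'cV[R]_p, f @ U --> l.
Proof.
move=> UU fr; have [|l _ ?] := ultra_cvg (f := f) UU (@compact_enorm_ball 0 r).
  by apply: filterS fr => k /=; rewrite subr0.
by exists l.
Qed.

Lemma enorm_ball_min (f : 'cV[R]_p -> R) x r :
  (forall y, enorm (y - x) <= r -> {for y, continuous f}) -> 0 <= r ->
  exists2 z, enorm (z - x) <= r & forall y, enorm (y - x) <= r -> f z <= f y.
Proof.
move=> cf r0; have [||z] := compact_EVT_min _ (@compact_enorm_ball x r) (f := f).
- by exists x; rewrite /= subrr enorm0.
- by apply: continuous_in_subspaceT => y; rewrite inE => /cf.
by rewrite inE => zr zmin; exists z => // y yr; apply: zmin; rewrite inE.
Qed.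

End Topology.

Lemma cvg_mulmx (R : realType) (p q : nat) (A : 'M[R]_(q, p)) (I : Type)
    (F : set_system I) {FF : Filter F} (f : I -> 'cV[R]_p) (l : 'cV[R]_p) :
  f @ F --> l -> A *m f k @[k --> F] --> A *m l.
Proof.
move=> fl; apply: cvg_coord => i.
have E v : (A *m v) i ord0 = dot (row i A)^T v.
  by rewrite !mxE; apply: eq_bigr => j _; rewrite !mxE.
rewrite E; under eq_fun do rewrite E.
by apply: cvg_dot => //; exact: cvg_cst.
Qed.

(** * Finite convex functions: continuity and first-order optimality *)

Section Convex.
Variables (R : realType) (p : nat).
Implicit Types (u v w x y z : 'cV[R]_p) (J : 'cV[R]_p -> R).

Definition convexE J := forall x y t, 0 <= t <= 1 ->
  J (t *: x + (1 - t) *: y) <= t * J x + (1 - t) * J y.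

Lemma convex_functionE J : @convex_function R 'cV[R]_p setT J -> convexE J.
Proof.
move=> cJ x y t /andP[t0 t1].
exact: (cJ (Itv01 t0 t1) x y (in_setT _) (in_setT _)).
Qed.

Lemma convexE_shift J x : convexE J -> convexE (fun h => J (x + h) - J x).
Proof.
move=> cJ u v t t01; have := cJ (x + u) (x + v) t t01.
have -> : t *: (x + u) + (1 - t) *: (x + v) = x + (t *: u + (1 - t) *: v).
  by rewrite !scalerDr addrACA -scalerDl addrC addrC subrKC scale1r.
by lra.
Qed.

(** The sum is a convex combination with weights 1/2, 1/4, ...; the leftover mass sits at 0, where
    [J] vanishes. The induction peels off one midpoint at a time. *)
Lemma convexE_sum_half J n (h : 'I_n -> 'cV[R]_p) : convexE J -> J 0 = 0 ->
  J (\sum_i h i) <= \sum_(i < n) 2^-1 ^+ i.+1 * J (2 ^+ i.+1 *: h i).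
Proof.
move=> cJ J0; elim: n h => [|n IH] h; first by rewrite !big_ord0 J0.
rewrite !big_ord_recl /= expr1 expr1.
have half01 : 0 <= (2^-1 : R) <= 1 by lra.
have := cJ (2 *: h ord0) (2 *: \sum_(i < n) h (lift ord0 i)) _ half01.
rewrite (_ : 1 - 2^-1 = 2^-1 :> R); last by lra.
rewrite !scalerA !mulVf ?pnatr_eq0// !scale1r => /le_trans; apply.
rewrite lerD2l scaler_sumr.
apply: (@le_trans _ _ (2^-1 * \sum_(i < n) 2^-1 ^+ i.+1 *
    J (2 ^+ i.+1 *: (2 *: h (lift ord0 i))))).
  by rewrite ler_pM2l ?invr_gt0 ?ltr0n//; exact: IH.
rewrite mulr_sumr; apply: ler_sum => i _.
by rewrite mulrA -exprS scalerA -exprSr.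
Qed.

Lemma convexE_line J v t : convexE J -> J 0 = 0 -> `|t| <= 1 ->
  J (t *: v) <= `|t| * (`|J v| + `|J (- v)|).
Proof.
move=> cJ J0.
have pos w s : 0 <= s <= 1 -> J (s *: w) <= s * `|J w|.
  move=> /[dup] s01 /andP[s0 s1]; have := cJ w 0 s s01.
  rewrite scaler0 addr0 J0 mulr0 addr0 => /le_trans; apply.
  by rewrite ler_wpM2l// ler_norm.
have [t0|t0] := leP 0 t.
  rewrite ger0_norm// => t1; apply: le_trans (pos v t _) _; first by rewrite t0.
  by rewrite ler_wpM2l// lerDl.
rewrite ltr0_norm// => t1; rewrite -[t *: v]opprK -scalerN -scaleNr.
apply: le_trans (pos (- v) (- t) _) _; first by lra.
by rewrite ler_wpM2l ?lerDr//; lra.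
Qed.

(** The upper bound splits [h] along the basis; the radius [2^-1 ^+ p] keeps each coordinate, scaled
    by at most [2 ^+ p], within [[-1, 1]]. The lower bound follows from the upper one at [- h],
    since 0 is the midpoint of [h] and [- h]. *)
Lemma convexE_lipschitz J x : convexE J -> exists K d, 0 < d /\
  forall h, enorm h <= d -> `|J (x + h) - J x| <= K * enorm h.
Proof.
move=> cJ; pose D h := J (x + h) - J x.
have cD : convexE D by exact: convexE_shift.
have D0 : D 0 = 0 by rewrite /D addr0 subrr.
pose K_ i := `|D (delta_mx i ord0)| + `|D (- delta_mx i ord0)|.
have ub h : enorm h <= 2^-1 ^+ p -> D h <= (\sum_i K_ i) * enorm h.
  move=> hd; have -> : D h = D (\sum_i h i ord0 *: delta_mx i ord0).
    congr D; apply/colP => j; rewrite summxE (bigD1 j)//= !mxE !eqxx mulr1.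
    by rewrite big1 ?addr0// => i ij; rewrite !mxE eq_sym (negbTE ij) mulr0.
  apply: le_trans (convexE_sum_half _ cD D0) _.
  rewrite mulr_suml; apply: ler_sum => i _; rewrite scalerA.
  have hi := coord_le_enorm h i.
  have p2 : 0 < (2 ^+ i.+1 : R) by rewrite exprn_gt0.
  have le1 : `|2 ^+ i.+1 * h i ord0| <= 1.
    rewrite normrM gtr0_norm// mulrC -ler_pdivlMr// mul1r -exprVn.
    rewrite (le_trans hi)// (le_trans hd)// ler_wiXn2l ?ltn_ord//; lra.
  apply: (@le_trans _ _ (2^-1 ^+ i.+1 * (`|2 ^+ i.+1 * h i ord0| * K_ i))).
    by rewrite ler_pM2l ?exprn_gt0 ?invr_gt0//; exact: convexE_line.
  rewrite normrM (gtr0_norm p2) !mulrA -exprMn mulVf ?pnatr_eq0// expr1n mul1r.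
  by rewrite mulrC ler_wpM2l// /K_ addr_ge0.
exists (\sum_i K_ i), (2^-1 ^+ p); split; first by rewrite exprn_gt0 ?invr_gt0.
move=> h hd; rewrite -/(D h) ler_norml ub// andbT.
have := ub (- h); rewrite enormN => /(_ hd).
have half01 : 0 <= (2^-1 : R) <= 1 by lra.
have := cD h (- h) _ half01.
rewrite (_ : 1 - 2^-1 = 2^-1 :> R); last by lra.
by rewrite scalerN subrr D0; lra.
Qed.

Lemma convexE_continuous J : convexE J -> continuous J.
Proof.
move=> cJ x; have [K [d [d0 Kd]]] := convexE_lipschitz x cJ.
apply/(@cvgrPdist_le _ _ _ (nbhs x) (nbhs_filter x)) => e e0.
have K0 : 0 < `|K| + 1 by rewrite ltr_wpDl.
apply/nbhs_enormP; exists (Num.min d (e / (`|K| + 1))).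
  by rewrite lt_min d0 divr_gt0.
move=> y; rewrite lt_min => /andP[/ltW yd /ltW]; rewrite ler_pdivlMr// => ye.
rewrite distrC; have := Kd _ yd; rewrite subrKC => /le_trans; apply.
apply: le_trans ye; rewrite mulrC ler_wpM2l ?enorm_ge0//.
by rewrite (le_trans (ler_norm _))// lerDl.
Qed.

(* A quadratic term centred at [z] does not affect first-order optimality. *)
Lemma convexE_min_linearize J (g K : R) (r : 'cV[R]_p) z : convexE J -> 0 <= g ->
  (forall y, g * J z <= g * J y + dot r (y - z) + K * enorm (y - z) ^+ 2) ->
  forall y, g * J z <= g * J y + dot r (y - z).
Proof.
move=> cJ g0 h y; set s := dot r (y - z); set N := enorm (y - z) ^+ 2.
(* The hypothesis at a convex combination, divided by [t]: the quadratic term keeps one factor [t]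
   and disappears as [t] shrinks. *)
have key t : 0 < t <= 1 -> g * J z <= g * J y + s + t * (K * N).
  move=> /andP[t0 t1]; have := h (t *: y + (1 - t) *: z).
  rewrite (_ : _ - z = t *: (y - z)); last first.
    by apply/colP => i; rewrite !mxE; ring.
  rewrite dotZr enormZ exprMn real_normK ?num_real// -/s -/N.
  have tt : 0 <= t <= 1 by rewrite t1 (ltW t0).
  have := ler_wpM2l g0 (cJ y z t tt) => c1 c2.
  rewrite -(ler_pM2l t0); move: c1 c2; set a := J _.
  by move=> c1 c2; have := le_trans c2 (lerD (lerD c1 (lexx _)) (lexx _)); lra.
apply/ler_addgt0Pr => e e0.
have N0 : 0 < `|K * N| + 1 by rewrite ltr_wpDl.
have t0 : 0 < Num.min 1 (e / (`|K * N| + 1)) by rewrite lt_min ltr01 divr_gt0.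
apply: le_trans (key (Num.min 1 (e / (`|K * N| + 1))) _) _.
  by rewrite t0 ge_min lexx.
rewrite lerD2l (@le_trans _ _ (e / (`|K * N| + 1) * (`|K * N| + 1)))//; last first.
  by rewrite divfK// gt_eqF.
apply: le_trans (ler_norm _) _; rewrite normrM (gtr0_norm t0).
by rewrite ler_pM// ?(ltW t0) ?ge_min ?lexx ?orbT// lerDl.
Qed.

End Convex.

(** * Subdifferentials, optimality conditions and the proximal map *)

Section Subdifferential.
Variables (R : realType) (p : nat).
Implicit Types (u v w x y z b : 'cV[R]_p) (A : 'M[R]_p) (J : 'cV[R]_p -> R).

Lemma subdiff_monotone J x y g h : subdiff J x g -> subdiff J y h ->
  0 <= dot (g - h) (x - y).
Proof. by move=> /(_ y) + /(_ x); rewrite !dotlin; lra. Qed.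

Lemma subdiff_closed (I : Type) (F : set_system I) {FF : ProperFilter F} J
    (x g : I -> 'cV[R]_p) x' g' : continuous J ->
  x @ F --> x' -> g @ F --> g' -> (\forall k \near F, subdiff J (x k) (g k)) ->
  subdiff J x' g'.
Proof.
move=> cJ xx' gg' h y.
have c1 : J (x k) + dot (g k) (y - x k) @[k --> F] --> J x' + dot g' (y - x').
  apply: cvgD; first exact: (cvg_comp _ _ xx' (cJ x')).
  by apply: cvg_dot => //; apply: cvgB xx'; exact: cvg_cst.
apply: (closed_cvg _ (@closed_le R (J y)) _ _ c1).
by apply: filterS h => k /(_ y).
Qed.

Lemma min_exists (f : 'cV[R]_p -> R) x r : continuous f -> 0 <= r ->
  (forall y, f y <= f x -> enorm (y - x) <= r) ->
  exists z, forall y, f z <= f y.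
Proof.
move=> cf r0 h; have [z zr zmin] := enorm_ball_min (fun y (_ : enorm (y - x) <= r) => cf y) r0.
exists z => y; have [yr|yr] := leP (enorm (y - x)) r; first exact: zmin.
apply: le_trans (zmin x _) _; first by rewrite subrr enorm0.
by rewrite leNgt; apply: contraTN yr => /ltW/h; rewrite -leNgt.
Qed.

(** Expanding the quadratic form around [z] leaves a linear term and a remainder bounded by
    [2^-1 * opnorm A] times the squared distance, which [convexE_min_linearize] removes. *)
Lemma subdiff_of_min J (mu : R) A b z : convexE J -> 0 < mu -> psd A ->
  (forall y, mu * J z + 2^-1 * dot (A *m z) z - dot b z <=
             mu * J y + 2^-1 * dot (A *m y) y - dot b y) ->
  subdiff J z (mu^-1 *: (b - A *m z)).
Proof.
move=> cJ mu0 Apsd h y; have [_ A0] := Apsd.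
have := @convexE_min_linearize _ _ J mu (2^-1 * opnorm A) (A *m z - b) z cJ (ltW mu0).
move=> /(_ _ y) lin; rewrite -(ler_pM2l mu0) mulrDr dotZl mulrA mulfV ?gt_eqF//.
rewrite mul1r -[b - _]opprB dotNl lerBlDr; apply: lin => w.
have [v ->] : exists v, w = z + v by exists (w - z); rewrite subrKC.
have := h (z + v); rewrite (_ : z + v - z = v); last by rewrite addrAC subrr add0r.
have : dot (A *m v) v <= opnorm A * enorm v ^+ 2.
  by apply: le_trans (dot_le _ _) _; rewrite expr2 mulrA ler_wpM2r ?enorm_ge0 ?opnorm_le.
by rewrite mulmxDr !dotlin (psd_dotC v z Apsd); lra.
Qed.

Lemma continuous_quadratic A b :
  continuous (fun y => 2^-1 * dot (A *m y) y - dot b y).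
Proof.
move=> y; have Fy := nbhs_filter y.
have cA : A *m y' @[y' --> y] --> A *m y.
  exact: (@cvg_mulmx _ _ _ A _ (nbhs y) Fy id y cvg_id).
apply: (@cvgB _ R^o _ _ Fy); last first.
  exact: (@cvg_dot _ _ _ (nbhs y) Fy (fun=> b) id _ _ (cvg_cst b) cvg_id).
apply: (@cvgM _ _ _ Fy) (cvg_cst _) _.
exact: (@cvg_dot _ _ _ (nbhs y) Fy (mulmx A) id _ _ cA cvg_id).
Qed.

(** Completing the square turns the proximal objective into the quadratic model with identity
    matrix. Existence of a minimiser has to be shown first, as [prox] falls back to 0 on an empty
    [argmin]. *)
Lemma prox_subdiff J (g : R) x : convexE J -> (forall y, 0 <= J y) -> 0 < g ->
  subdiff J (prox g J x) (g^-1 *: (x - prox g J x)).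
Proof.
move=> cJ J0 g0; pose f y := g * J y + (2^-1 * dot (1%:M *m y) y - dot x y).
have fE y : 2^-1 * enorm (x - y) ^+ 2 + g * J y = f y + 2^-1 * dot x x.
  by rewrite /f mul1mx sqr_enorm !dotlin (dotC y x); lra.
(* On the sublevel set of [x] the squared distance is at most [2 * (g * J x)], as [J] is
   nonnegative; a radius at least 1 then bounds the distance itself without a square root. *)
have [|||z zmin] := @min_exists f x (2 * (g * J x) + 1).
- move=> y; have Fy := nbhs_filter y.
  apply: (@cvgD _ R^o _ _ Fy); last exact: continuous_quadratic.
  by apply: (@cvgM _ _ _ Fy) (cvg_cst _) _; exact: convexE_continuous.
- by rewrite addr_ge0// mulr_ge0// mulr_ge0// ltW.
- move=> y yx; have := fE y; have := fE x; rewrite subrr enorm0 expr0n /=.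
  rewrite enormBC; set n := enorm _ => e1 e2; have n0 : 0 <= n := enorm_ge0 _.
  have gx : 0 <= g * J x by rewrite mulr_ge0// ltW.
  have gy : 0 <= g * J y by rewrite mulr_ge0// ltW.
  have [//|nlt] := leP n (2 * (g * J x) + 1).
  have : n * (2 * (g * J x) + 1) <= n * n by rewrite ler_wpM2l// ltW.
  have : 2 * (g * J x) + 1 <= n * (2 * (g * J x) + 1).
    by rewrite ler_peMl; lra.
  by move: e2 e1 yx; rewrite expr2; lra.
have pmin : argmin (fun y => 2^-1 * enorm (x - y) ^+ 2 + g * J y) (prox g J x).
  by rewrite /prox; case: xgetP => // /(_ z) []; move=> y; rewrite !fE lerD2r.
have -> : x - prox g J x = x - 1%:M *m prox g J x by rewrite mul1mx.
apply: subdiff_of_min => //; first exact: psd1.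
by move=> y; have := pmin y; rewrite !fE lerD2r /f !addrA.
Qed.

End Subdifferential.

(** * Solving the local equation of a manifold along prescribed directions *)

Section Graph.
Variables (R : realType) (p m : nat).
Implicit Types (x y z v : 'cV[R]_p) (l : 'cV[R]_m).

Lemma linear_mx (f : {linear 'cV[R]_p -> 'cV[R]_m}) :
  exists A : 'M[R]_(m, p), forall v, f v = A *m v.
Proof.
exists (\matrix_(i, j) f (delta_mx j ord0) i ord0) => v.
rewrite {1}(matrix_sum_delta v) linear_sum; apply/colP => i.
rewrite summxE !mxE; apply: eq_bigr => j _.
by rewrite big_ord1 linearZ !mxE mulrC.
Qed.

Lemma diff_directional (f : 'cV[R]_p -> 'cV[R]_m) x v e :
  differentiable f x -> 0 < e ->
  exists2 d, 0 < d &
    forall t, 0 < t < d -> enorm (f (x + t *: v) - f x - t *: 'd f x v) <= t * e.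
Proof.
move=> df e0.
have : h^-1 *: ((f \o shift x) (h *: v) - f x) @[h --> 0^'] --> 'd f x v.
  by rewrite -deriveE//; exact: (diff_derivable (v := v) df).
move=> fv; have /cvgrPdist_le/(_ _ e0)[d d0 dP] :=
  (cvg_enorm_dist (FF := dnbhs_filter (0 : R)) _ _).1 fv.
exists d => // t /andP[t0 td].
have := dP t; rewrite /ball_/= !sub0r !normrN (gtr0_norm t0) => /(_ td).
rewrite gt_eqF// => /(_ isT); rewrite ger0_norm ?enorm_ge0// => h.
rewrite (_ : _ - _ = t *: (t^-1 *: (f (t *: v + x) - f x) - 'd f x v)).
  by rewrite enormZ gtr0_norm// ler_pM2l.
by rewrite scalerBr scalerA mulfV ?gt_eqF// scale1r (addrC x) addrC.
Qed.

(** The differential is only known to be continuous direction by direction; control of the finitely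
    many columns of [B] makes the estimate uniform in [l]. Dividing by [m.+1] also covers
    [m = 0]. *)
Lemma diff_uniform_near (f : 'cV[R]_p -> 'cV[R]_m) x e (B : 'M[R]_(p, m)) :
  (forall v, {for x, continuous (fun y => 'd f y v)}) -> 0 < e ->
  \forall y \near x, forall l,
    enorm ('d f y (B *m l) - 'd f x (B *m l)) <= e * enorm l.
Proof.
move=> dc e0; have e1 : 0 < e / m.+1%:R by rewrite divr_gt0.
have : \forall y \near x, forall j : 'I_m,
    enorm ('d f y (B *m delta_mx j ord0) - 'd f x (B *m delta_mx j ord0)) <= e / m.+1%:R.
  apply: (filter_forall (nbhs_filter x)) => j.
  have := (cvg_enorm_dist (FF := nbhs_filter x) _ _).1 (dc (B *m delta_mx j ord0)).
  move=> /(@cvgrPdist_le _ _ _ _ (nbhs_filter x))/(_ _ e1); apply: filterS => y.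
  by rewrite sub0r normrN ger0_norm ?enorm_ge0.
apply: filterS => y h l.
have [A AE] := linear_mx ('d f y); have [A' AE'] := linear_mx ('d f x).
pose D : 'M[R]_m := A *m B - A' *m B.
have DE (v : 'cV[R]_m) : 'd f y (B *m v) - 'd f x (B *m v) = D *m v.
  apply: (etrans (congr2 (fun a b => a - b) (AE _) (AE' _))).
  by rewrite mulmxBl !mulmxA.
have -> : 'd f y (B *m l) - 'd f x (B *m l) =
    \sum_j l j ord0 *: (D *m delta_mx j ord0).
  apply: (etrans (DE l)).
  rewrite {1}(matrix_sum_delta l) mulmx_sumr; apply: eq_bigr => j _.
  by rewrite big_ord1 -scalemxAr.
apply: (@le_trans _ _ (\sum_(j < m) enorm l * (e / m.+1%:R))).
  apply: (big_ind2 (fun (u : 'cV[R]_m) a => enorm u <= a)).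
  - by rewrite enorm0.
  - by move=> u a w b ua wb; rewrite (le_trans (enormD _ _))// lerD.
  - move=> j _; rewrite enormZ ler_pM ?enorm_ge0 ?coord_le_enorm//.
    by have := h j; rewrite (DE (delta_mx j ord0)).
rewrite sumr_const card_ord -[leLHS]mulr_natr -mulrA mulrC ler_wpM2r ?enorm_ge0//.
by rewrite -mulrA ler_piMr ?(ltW e0)// mulrC ler_pdivrMr// mul1r ler_nat.
Qed.

(* Solving [G (z - B l) = 0] for [l] replaces the implicit function theorem. The
   minimiser of [|G (z - B l)| + |l| / 4] on a small ball is interior because the
   value at [0] is small; if [G] did not vanish there, a Newton step along
   [G (z - B l)] would decrease the first term at rate at least 3/8 and increase
   the second at rate at most 1/4. *)
Lemma local_equation_solve (G : 'cV[R]_p -> 'cV[R]_m) x (B : 'M[R]_(p, m)) rho :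
  G x = 0 -> (\forall y \near x, differentiable G y) ->
  (forall v, {for x, continuous (fun y => 'd G y v)}) ->
  (forall l, 'd G x (B *m l) = l) -> 0 < rho ->
  \forall z \near x, exists l,
    enorm (z - B *m l - x) < rho /\ G (z - B *m l) = 0.
Proof.
move=> Gx dG cdG GB rho0.
have half0 : 0 < (2^-1 : R) by rewrite invr_gt0.
have /nbhs_enormP[e1 e10 dGy] := dG.
have /nbhs_enormP[e2 e20 near_dG] := diff_uniform_near B cdG half0.
have inv y : enorm (y - x) < e2 -> forall l,
    enorm ('d G y (B *m l) - l) <= 2^-1 * enorm l.
  move=> yx l; apply: le_trans (near_dG y yx l).
  rewrite le_eqVlt; apply/orP; left; apply/eqP.
  exact: (congr1 (fun w => enorm ('d G y (B *m l) - w)) (esym (GB l))).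
pose e := Num.min rho (Num.min e1 e2).
have e0 : 0 < e by rewrite !lt_min rho0 e10.
have [K K0 BK] := mulmx_enorm_bounded B.
(* With [enorm l <= r] the displacement [B *m l] costs at most [e / 2]; the other half is left for
   the distance from [z] to [x]. *)
pose r := e / (2 * K).
have r0 : 0 < r by rewrite divr_gt0// mulr_gt0.
have cGx : G y @[y --> x] --> G x.
  by apply: differentiable_continuous; apply: dGy; rewrite subrr enorm0.
have r40 : 0 < r / 4 by rewrite divr_gt0.
have : \forall z \near x, enorm (G z) < r / 4.
  have := (cvg_enorm_dist (FF := nbhs_filter x) _ _).1 cGx.
  move=> /(@cvgrPdist_lt _ _ _ _ (nbhs_filter x))/(_ _ r40); apply: filterS => z.
  by rewrite Gx subr0 sub0r normrN ger0_norm ?enorm_ge0.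
have : \forall z \near x, enorm (z - x) < e / 2.
  by apply/nbhs_enormP; exists (e / 2); rewrite ?divr_gt0.
apply: filterS2 => z zx Gz.
have near_x l : enorm l <= r -> enorm (z - B *m l - x) < e.
  move=> lr; rewrite addrAC (le_lt_trans (enormB _ _))//.
  suff : enorm (B *m l) <= e / 2 by lra.
  rewrite (le_trans (BK l))// (@le_trans _ _ (K * r))// ?ler_pM2l//.
  by have -> : K * r = e / 2 by rewrite /r; field; rewrite gt_eqF.
have lt_e1 l : enorm l <= r -> enorm (z - B *m l - x) < e1.
  by move=> /near_x; rewrite !lt_min => /and3P[].
have lt_e2 l : enorm l <= r -> enorm (z - B *m l - x) < e2.
  by move=> /near_x; rewrite !lt_min => /and3P[].
pose psi l := enorm (G (z - B *m l)) + 4^-1 * enorm l.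
have cpsi l : enorm (l - 0) <= r -> {for l, continuous psi}.
  rewrite subr0 => lr; have Fl := nbhs_filter l.
  apply: (@cvgD _ R^o _ _ Fl).
    apply: (@cvg_enorm _ _ _ _ Fl (fun l' => G (z - B *m l'))).
    have cB : z - B *m l' @[l' --> l] --> z - B *m l.
      apply: (@cvgB _ _ _ _ Fl) (cvg_cst _) _.
      exact: (@cvg_mulmx _ _ _ B _ _ Fl id l cvg_id).
    have cG := differentiable_continuous (dGy _ (lt_e1 _ lr)).
    exact: (@cvg_comp _ _ _ (fun l' => z - B *m l') G _ _ _ cB cG).
  apply: (@cvgM _ _ _ Fl) (cvg_cst _) _.
  exact: (@cvg_enorm _ _ _ _ Fl id l cvg_id).
have [l] := enorm_ball_min cpsi (ltW r0); rewrite subr0 => lr lmin.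
exists l; split.
  by move: (near_x _ lr); rewrite !lt_min => /and3P[].
have lr' : enorm l < r.
  have := lmin 0; rewrite subrr enorm0 => /(_ (ltW r0)).
  rewrite /psi mulmx0 subr0 enorm0 mulr0 addr0.
  by have := enorm_ge0 (G (z - B *m l)); lra.
set y := z - B *m l; apply: contrapT => /eqP Gy0.
set h := G y in Gy0; have h0 := enorm_gt0 Gy0.
have h80 : 0 < enorm h / 8 by rewrite divr_gt0.
have [d d0 dP] := diff_directional (- (B *m h)) (dGy _ (lt_e1 _ lr)) h80.
(* The three bounds respectively put [t] in the range of the directional expansion, keep [1 - t]
   nonnegative, and keep [l + t *: h] in the ball. *)
pose t := Num.min (Num.min (d / 2) 1) ((r - enorm l) / enorm h).
have t0 : 0 < t by rewrite !lt_min ltr01 !divr_gt0 ?subr_gt0.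
have td : t < d.
  by rewrite !gt_min; apply/orP; left; apply/orP; left; rewrite ltr_pdivrMr// ltr_pMr// ltr1n.
have t1 : t <= 1 by rewrite !ge_min lexx orbT.
have th : t * enorm h <= r - enorm l by rewrite -ler_pdivlMr// ge_min lexx orbT.
have lth : enorm (l + t *: h) <= enorm l + t * enorm h.
  by rewrite (le_trans (enormD _ _))// enormZ gtr0_norm.
have := lmin (l + t *: h); rewrite subr0 => lmin'.
have {lmin'} : psi l <= psi (l + t *: h) by apply: lmin'; lra.
have := dP t; rewrite t0 td => /(_ isT).
have := inv _ (lt_e2 _ lr) h; rewrite -/y.
rewrite /psi mulmxDr opprD addrA -scalemxAr -scalerN -/y.
set Gt := G (y + _).
have [A AE] := linear_mx ('d G y); rewrite !AE mulmxN !scalerN opprK.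
set D := A *m _; rewrite -/h => c1 c2.
have : enorm Gt <= (1 - t) * enorm h + t * (2^-1 * enorm h) + t * (enorm h / 8).
  (* The three pieces are an exact Newton step, the defect of [B] as a right inverse at [y], and the
     error of the first-order expansion. *)
  have -> : Gt = (1 - t) *: h + (- t) *: (D - h) + (Gt - h + t *: D).
    by apply/colP => i; rewrite !mxE; ring.
  rewrite (le_trans (enormD _ _))// lerD// (le_trans (enormD _ _))// lerD//.
    by rewrite enormZ ger0_norm// subr_ge0.
  by rewrite enormZ normrN gtr0_norm// ler_pM2l.
have -> : G (y - t *: (B *m h)) = Gt by rewrite /Gt scalerN.
by have := mulr_gt0 t0 h0; lra.
Qed.

End Graph.

(** * Orthogonal projections, linear spans and the relative interior *)

Section Orthogonality.
Variables (R : realType) (p : nat).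
Implicit Types (u v w x y : 'cV[R]_p) (C T : set 'cV[R]_p) (P : 'M[R]_p).

Lemma orthZ C a v : orth C v -> orth C (a *: v).
Proof. by move=> Cv c /Cv vc; rewrite dotZl vc mulr0. Qed.

Lemma orth_closed C (I : Type) (F : set_system I) {FF : ProperFilter F}
    (f : I -> 'cV[R]_p) l : f @ F --> l -> (\forall k \near F, orth C (f k)) ->
  orth C l.
Proof.
move=> fl Cf c Cc.
have h : dot (f k) c @[k --> F] --> dot l c by apply: cvg_dot fl (cvg_cst c).
apply: (closed_cvg _ (@closed_eq R 0) _ _ h).
by apply: filterS Cf => k; apply.
Qed.

Lemma is_orth_proj_sym T P : is_orth_proj T P -> P^T = P.
Proof.
move=> PT; have PP u v : dot (P *m u) v = dot (P *m u) (P *m v).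
  have [_ /(_ (P *m u) (PT u).1)] := PT v.
  by rewrite dotBl (dotC v) => /eqP; rewrite subr_eq0 => /eqP ->; exact: dotC.
have sym u v : dot (P *m u) v = dot u (P *m v).
  by rewrite PP dotC -PP dotC.
apply/matrixP => i j; rewrite mxE.
have E (B : 'M[R]_p) k l : B k l = dot (delta_mx k ord0) (B *m delta_mx l ord0).
  rewrite -colE /dot (bigD1 k)//= !mxE !eqxx mul1r big1 ?addr0// => k' k'k.
  by rewrite !mxE (negbTE k'k) mul0r.
by rewrite E -sym dotC -E.
Qed.

Lemma orth_projP T P : is_orth_proj T P -> is_orth_proj T (orth_proj T).
Proof. by move=> PT; rewrite /orth_proj; case: xgetP => // /(_ P). Qed.

(** Take [B] to be [A^T] times the inverse of [A *m A^T]: its range is the row space of [A], the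
    orthogonal complement of the kernel. The Gram matrix is invertible because surjectivity gives
    [A] a right inverse. *)
Lemma kernel_orth_split (m : nat) (A : 'M[R]_(m, p)) :
  (forall w : 'cV[R]_m, exists v, A *m v = w) ->
  exists B : 'M[R]_(p, m), A *m B = 1%:M /\
    forall l : 'cV[R]_m, orth [set v | A *m v = 0] (B *m l).
Proof.
move=> /choice[f fP]; pose D := \matrix_(i, j) f (delta_mx j ord0) i ord0.
have AD : A *m D = 1%:M.
  apply/matrixP => i j; have := congr1 (fun u : 'cV[R]_m => u i ord0) (fP (delta_mx j ord0)).
  rewrite !mxE eqxx andbT => <-; apply: eq_bigr => k _; by rewrite mxE.
have AAu : A *m A^T \in unitmx.
  rewrite -row_free_unit; apply: inj_row_free => u uAA.
  suff uA : u *m A = 0 by rewrite -[u]mulmx1 -AD mulmxA uA mul0mx.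
  apply: trmx_inj; rewrite trmx0; apply: enorm_eq0.
  rewrite /enorm dotE trmxK trmx_mul -mulmxA (mulmxA A).
  by rewrite mulmxA uAA mul0mx mxE sqrtr0.
exists (A^T *m invmx (A *m A^T)); split; first by rewrite mulmxA mulmxV.
move=> l v /= Av.
by rewrite dotE -mulmxA trmx_mul trmxK -mulmxA Av mulmx0 mxE.
Qed.

Lemma kernel_orth_proj (m : nat) (A : 'M[R]_(m, p)) (B : 'M[R]_(p, m)) :
  A *m B = 1%:M -> (forall l : 'cV[R]_m, orth [set v | A *m v = 0] (B *m l)) ->
  is_orth_proj [set v | A *m v = 0] (1%:M - B *m A).
Proof.
move=> AB oB v; rewrite mulmxBl mul1mx /=; split.
  by rewrite mulmxBr -mulmxA mulmxA AB mul1mx subrr.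
by rewrite opprB subrKC -mulmxA; exact: oB.
Qed.

(** Appending a vector of [S] outside the row space raises the rank, which cannot exceed [p]; [k]
    bounds the number of extensions still possible. *)
Lemma span_finite (S : set 'cV[R]_p) :
  exists (m : nat) (D : 'M[R]_(m, p)), (forall i, S (row i D)^T) /\
    forall v, S v -> (v^T <= D)%MS.
Proof.
suff grow k m (D : 'M[R]_(m, p)) : (forall i, S (row i D)^T) ->
    (p <= \rank D + k)%N ->
    exists (m : nat) (D : 'M[R]_(m, p)), (forall i, S (row i D)^T) /\
      forall v, S v -> (v^T <= D)%MS.
  by apply: (grow p 0%N 0) => [[]//|]; rewrite leq_addl.
elim: k m D => [|k IH] m D DS rk.
  exists m, D; split => // v _; apply: submx_full.
  by rewrite /row_full eqn_leq rank_leq_col -[X in (_ <= X)%N]addn0.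
have [DP|] := pselect (forall v, S v -> (v^T <= D)%MS); first by exists m, D.
move=> /existsNP[v /not_implyP[Sv /negP vD]].
apply: (IH _ (col_mx D v^T)) => [i|].
  case: (split_ordP i) => j ->; first by rewrite rowKu.
  by rewrite rowKd (ord1 j) row_id trmxK.
have : (\rank D < \rank (col_mx D v^T))%N.
  rewrite ltn_neqAle mxrankS ?andbT; last by rewrite -addsmxE addsmxSl.
  apply: contraNN vD => /eqP e; have : (D == col_mx D v^T)%MS.
    by rewrite -mxrank_leqif_eq ?e// -addsmxE addsmxSl.
  by move=> /eqmxP DE; rewrite DE -addsmxE addsmxSr.
by move=> lt; apply: leq_trans rk _; rewrite addnS -addSn leq_add2r.
Qed.

(** The double orthogonal of [vec_hull C] is the direction of the affine hull, so [x + c *: n] stays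
    in the hull, and half the radius of the neighbourhood in [ri] serves as [c]. *)
Lemma ri_direction C x : ri C x -> exists2 c, 0 < c &
  forall n, orth (orth (vec_hull C)) n -> enorm n <= 1 -> C (x + c *: n).
Proof.
move=> [Cx /nbhs_enormP[e e0 eC]]; exists (e / 2); first by rewrite divr_gt0.
move=> n On n1; apply: eC.
  rewrite addrAC subrr add0r enormZ gtr0_norm ?divr_gt0//.
  apply: (@le_lt_trans _ _ (e / 2)); first by rewrite ler_piMr// divr_ge0// ltW.
  by rewrite ltr_pdivrMr// ltr_pMr// ltr1n.
have [m [D [DS Dspan]]] := span_finite [set v | C (x + v)].
(* Membership in the row space is tested against the columns of the cokernel; these are orthogonal
   to all differences of points of [C], hence to [n]. *)
have nD : (n^T <= D)%MS.
  rewrite submxE; apply/eqP/rowP => j; rewrite [RHS]mxE.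
  have -> : (n^T *m cokermx D) ord0 j = dot n (col j (cokermx D)).
    by rewrite dotE !mxE; apply: eq_bigr => k _; rewrite !mxE.
  apply: On => _ [y [z [rho [Cy Cz ->]]]].
  have hull0 w : C w -> dot (col j (cokermx D)) (w - x) = 0.
    move=> Cw; have /submxP[E wE] : ((w - x)^T <= D)%MS.
      by apply: Dspan; rewrite /= subrKC.
    by rewrite dotC dotE wE colE -mulmxA (mulmxA D) mulmx_coker mul0mx mulmx0 mxE.
  rewrite dotZr (_ : y - z = (y - x) - (z - x)); last by rewrite opprB addrA subrK.
  by rewrite dotBr !hull0// subrr mulr0.
have /submxP[a aE] := nD; set c := e / 2.
(* Index 0 carries the base point [x] with the weight that makes the total equal to 1. *)
pose w (i : 'I_m.+1) := if unlift ord0 i is Some j then c * a ord0 j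
  else 1 - \sum_j c * a ord0 j.
pose y (i : 'I_m.+1) := if unlift ord0 i is Some j then x + (row j D)^T else x.
exists m.+1, w, y; split.
- by move=> i; rewrite /y; case: unliftP => [j _|_]//; exact: DS.
- rewrite big_ord_recl /w unlift_none.
  rewrite [X in _ + X](eq_bigr (fun j => c * a ord0 j)) ?subrK// => j _.
  by rewrite liftK.
- rewrite big_ord_recl /w /y unlift_none.
  rewrite [X in _ = _ + X](eq_bigr (fun j => (c * a ord0 j) *: x +
    (c * a ord0 j) *: (row j D)^T)); last by move=> j _; rewrite liftK scalerDr.
  rewrite big_split/= -scaler_suml scalerBl scale1r addrA subrK; congr (x + _).
  rewrite -[n]trmxK aE mulmx_sum_row linear_sum scaler_sumr.
  by apply: eq_bigr => j _; rewrite linearZ scalerA.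
Qed.

End Orthogonality.

(** * Identification of the manifold from nearby subgradients *)

Section Identification.
Variables (R : realType) (p : nat).
Implicit Types (u v w x y z : 'cV[R]_p) (M T : set 'cV[R]_p)
  (J : 'cV[R]_p -> R).

(** Needed to know that [orth_proj] does not return its default value: the tangent space is the
    kernel of a surjective differential, for which the projection is explicit. *)
Lemma tangent_space_projection M x T : is_tangent_space M x T ->
  exists P, is_orth_proj T P.
Proof.
move=> [m [G [U [[_ _ _ Gsurj _] ->]]]].
have [A AE] := linear_mx ('d G x).
have [|B [AB oB]] := @kernel_orth_split _ _ _ A.
  by move=> w; have [v] := Gsurj w; rewrite AE; exists v.
exists (1%:M - B *m A); have -> : [set v | 'd G x v = 0] = [set v | A *m v = 0].
  by apply/seteqP; split => v /=; rewrite AE.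
exact: kernel_orth_proj.
Qed.

(** A substitute for the nearest-point projection onto [M]: [z] is moved by some [B *m l] until [G]
    vanishes. The displacement is thus normal to the tangent space at the fixed point [x] rather
    than at [y]. *)
Lemma tangent_space_normal_retract M x T rho : M x -> is_tangent_space M x T ->
  0 < rho -> \forall z \near x, exists y,
    [/\ M y, enorm (y - x) < rho & orth T (z - y)].
Proof.
move=> Mx [m [G [U [[Uo Ux GC2 Gsurj MU] ->]]]] rho0.
have [A AE] := linear_mx ('d G x).
have [|B [AB oB]] := @kernel_orth_split _ _ _ A.
  by move=> w; have [v] := Gsurj w; rewrite AE; exists v.
have nU : nbhs x U by apply: open_nbhs_nbhs.
have /nbhs_enormP[e e0 eU] := nU.
have Gx : G x = 0 by have [] : ([set y | G y = 0] `&` U) x by rewrite -MU.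
have GB l : 'd G x (B *m l) = l by rewrite AE mulmxA AB mul1mx.
have e'0 : 0 < Num.min rho e by rewrite lt_min rho0.
case: GC2 => Gdiff dGdiff.
have near_diff : \forall y \near x, differentiable G y.
  by move: nU; apply: filterS => y /Gdiff.
have dGcont v : {for x, continuous (fun y => 'd G y v)}.
  by apply: differentiable_continuous; apply: (dGdiff v).1.
have := local_equation_solve Gx near_diff dGcont GB e'0.
apply: filterS => z [l]; set y := z - B *m l.
rewrite lt_min => -[/andP[yrho ye] Gy]; exists y; split => //.
  by have [] : (M `&` U) y by rewrite MU; split => //; exact: eU.
rewrite /y opprB addrC subrK.
have -> : [set v | 'd G x v = 0] = [set v | A *m v = 0].
  by apply/seteqP; split => v /=; rewrite AE.
exact: oB.
Qed.

Lemma cvg_harmonic_bound (f : nat -> 'cV[R]_p) l :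
  (forall k, enorm (f k - l) <= k.+1%:R^-1) -> f @ \oo --> l.
Proof.
move=> fl; apply/cvg_enorm_dist.
apply: (@squeeze_cvgr _ _ _ _ (fun=> 0) (@harmonic R)); last 2 first.
- exact: cvg_cst.
- exact: cvg_harmonic.
by apply: nearW => k; rewrite enorm_ge0 fl.
Qed.

Lemma eventually_ultra : exists2 U : set_system nat, UltraFilter U & \oo `<=` U.
Proof. by have [U [UU oU]] := ultraFilterLemma eventually_filter; exists U. Qed.

(* Points [z] off [M] would be moved to [y] on [M] along the normal space;
   monotonicity against a subgradient at [y] near [eta + c n], where [n] is the
   limit of the normalised displacements, gives [- c |n|^2 >= 0]. *)
Lemma identification J M x eta : M x ->
  is_tangent_space M x (model_space J x) -> subdiff_continuous_at J M x ->
  ri (subdiff J x) eta ->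
  exists2 d, 0 < d & forall z g, enorm (z - x) < d -> enorm (g - eta) < d ->
    subdiff J z g -> M z.
Proof.
move=> Mx TM cJM /ri_direction[c c0 ric].
apply: contrapT => nd.
have /choice[f fP] k : exists t : 'cV[R]_p * 'cV[R]_p * 'cV[R]_p,
    let: (z, g, y) := t in
    [/\ subdiff J z g, ~ M z, M y, orth (model_space J x) (z - y) &
      enorm (g - eta) <= k.+1%:R^-1 /\ enorm (y - x) <= k.+1%:R^-1].
  have k0 : 0 < k.+1%:R^-1 :> R by rewrite invr_gt0.
  have /nbhs_enormP[d d0 dP] := tangent_space_normal_retract Mx TM k0.
  apply: contrapT => nk; apply: nd; exists (Num.min d k.+1%:R^-1).
    by rewrite lt_min d0.
  move=> z g; rewrite !lt_min => /andP[zd _] /andP[_ gk] zg.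
  apply: contrapT => nMz; apply: nk; have [y [My yx zy]] := dP z zd.
  by exists (z, g, y); split => //; split; exact: ltW.
pose z k := (f k).1.1; pose g k := (f k).1.2; pose y k := (f k).2.
have {}fP k : [/\ subdiff J (z k) (g k), ~ M (z k), M (y k),
    orth (model_space J x) (z k - y k) &
    enorm (g k - eta) <= k.+1%:R^-1 /\ enorm (y k - x) <= k.+1%:R^-1].
  by have := fP k; rewrite /z /g /y; case: (f k) => [[]].
have yM k : M (y k) by have [] := fP k.
have yx : y @ \oo --> x by apply: cvg_harmonic_bound => k; have [_ _ _ _ []] := fP k.
have geta : g @ \oo --> eta by apply: cvg_harmonic_bound => k; have [_ _ _ _ []] := fP k.
have zy0 k : z k - y k != 0.
  rewrite subr_eq0; have [_ nMz My _ _] := fP k.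
  by apply/eqP => e; apply: nMz; rewrite e.
pose n k := (enorm (z k - y k))^-1 *: (z k - y k).
have n1 k : enorm (n k) = 1.
  have h := enorm_gt0 (zy0 k).
  by rewrite enormZ gtr0_norm ?invr_gt0// mulVf// gt_eqF.
have [U UU oU] := eventually_ultra; have PU := @ultra_proper _ _ UU.
have [l nl] : exists l : 'cV[R]_p, n @ U --> l.
  by apply: (bounded_ultra_cvg (r := 1)); apply: filterE => k /=; rewrite n1.
have l1 : enorm l = 1.
  apply: (closed_cvg _ (@closed_eq R 1) _ _ (cvg_enorm nl)).
  exact: filterE n1.
have ol : orth (model_space J x) l.
  apply: (orth_closed nl); apply: filterE => k; apply: orthZ.
  by have [] := fP k.
have subl : subdiff J x (eta + c *: l) by apply: ric; rewrite ?l1.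
(* Continuity of the subdifferential is available only along [M], hence it is applied to the points
   [y], not to [z]. *)
have [/(_ _ subl)[eta' eta'P eta'l] _] : _ := cJM y (fun k => let: And5 _ _ h _ _ := fP k in h) yx.
have mono k : 0 <= dot (g k - eta' k) (n k).
  have [zg _ _ _ _] := fP k.
  by rewrite dotZr mulr_ge0 ?invr_ge0 ?enorm_ge0//; exact: subdiff_monotone.
have lim : dot (g k - eta' k) (n k) @[k --> U] --> dot (eta - (eta + c *: l)) l.
  by apply: cvg_dot nl; apply: cvgB => A /[dup] ? hA; apply: oU; [exact: geta|exact: eta'l].
have : 0 <= dot (eta - (eta + c *: l)) l.
  by apply: (closed_cvg _ (@closed_ge R 0) _ _ lim); exact: filterE.
rewrite opprD addNKr dotNl dotZl -sqr_enorm l1 expr1n mulr1.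
by rewrite oppr_ge0 leNgt c0.
Qed.

End Identification.

(** * Limits of perturbed matrices and a uniform growth estimate *)

Section Perturbation.
Variables (R : realType) (p : nat).
Implicit Types (u v w x y z q eps : 'cV[R]_p) (J : 'cV[R]_p -> R)
  (A P G : 'M[R]_p) (T : set 'cV[R]_p).

Lemma cvg_opnorm_mulmx (I : Type) (F : set_system I) {FF : Filter F}
    (A : I -> 'M[R]_p) A' (v : I -> 'cV[R]_p) v' :
  opnorm (A k - A') @[k --> F] --> 0 -> v @ F --> v' ->
  A k *m v k @[k --> F] --> A' *m v'.
Proof.
move=> AA' vv'; apply/(cvg_enorm_dist (fun k => A k *m v k)).
apply: (@squeeze_cvgr _ _ _ _ (fun=> 0)
  (fun k => opnorm (A k - A') * enorm (v k) + enorm (A' *m v k - A' *m v'))).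
- apply: filterE => k; rewrite enorm_ge0/=.
  have -> : A k *m v k - A' *m v' = (A k - A') *m v k + (A' *m v k - A' *m v').
    by rewrite mulmxBl addrA subrK.
  by rewrite (le_trans (enormD _ _))// lerD2r opnorm_le.
- exact: cvg_cst.
- rewrite -[X in _ --> X](addr0 (0 : R)) -[X in _ --> X + _](mul0r (enorm v')).
  apply: cvgD; first by apply: cvgM => //; exact: cvg_enorm.
  by apply/(cvg_enorm_dist (fun k => A' *m v k)); exact: cvg_mulmx.
Qed.

(** In the arguments by contradiction below, [Gt] inherits symmetry and positivity from the
    semidefinite matrices approaching it. *)
Lemma psd_limit (I : Type) (F : set_system I) {FF : ProperFilter F}
    (A : I -> 'M[R]_p) A' :
  opnorm (A k - A') @[k --> F] --> 0 -> (forall k, psd (A k)) -> psd A'.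
Proof.
move=> AA' Apsd.
have lim u v : dot (A k *m u) v @[k --> F] --> dot (A' *m u) v.
  by apply: cvg_dot (cvg_cst v); apply: cvg_opnorm_mulmx AA' (cvg_cst u).
split=> [|v]; last first.
  apply: (closed_cvg _ (@closed_ge R 0) _ _ (lim v v)).
  by apply: filterE => k; exact: (Apsd k).2.
have sym u v : dot (A' *m u) v = dot (A' *m v) u.
  apply/eqP; rewrite -subr_eq0; apply/eqP.
  have h : dot (A k *m u) v - dot (A k *m v) u @[k --> F] -->
      dot (A' *m u) v - dot (A' *m v) u by apply: cvgB; exact: lim.
  apply: (closed_cvg _ (@closed_eq R 0) _ _ h); apply: filterE => k /=.
  by rewrite psd_dotC ?subrr.
have E (B : 'M[R]_p) k l : B k l = dot (B *m delta_mx l ord0) (delta_mx k ord0).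
  rewrite -colE /dot (bigD1 k)//= !mxE !eqxx mulr1 big1 ?addr0// => k' k'k.
  by rewrite !mxE (negbTE k'k) mulr0.
by apply/matrixP => i j; rewrite mxE E sym -E.
Qed.

Variables (T : set 'cV[R]_p) (P Gt : 'M[R]_p) (q : 'cV[R]_p) (c : R).
Hypotheses (PT : is_orth_proj T P) (c0 : 0 < c).
Hypothesis Gt_inj : forall v, Gt *m v = 0 -> T v -> v = 0.
Local Notation eta := (Gt *m q).

(* With [v = mu * s], the inequality reads
   [<G s, s> / 2 + <eta, s> + c |s - P s| <= <eps / mu, s>]; a direction along
   which [s] is unbounded lies in [T] and in the kernel of [Gt]. *)
Lemma growth_bound : exists B C : R, [/\ 0 < B, 0 < C &
  forall mu G eps v, 0 < mu -> psd G -> opnorm (G - Gt) <= C ->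
    enorm eps <= C * mu ->
    2^-1 * dot (G *m v) v + mu * dot eta v + mu * (c * enorm (v - P *m v))
      <= dot eps v ->
    enorm v <= B * mu].
Proof.
apply: contrapT => nB.
have /choice[f fP] k : exists t : R * 'M[R]_p * 'cV[R]_p * 'cV[R]_p,
    let: (mu, G, eps, v) := t in
    [/\ 0 < mu, psd G, opnorm (G - Gt) <= k.+1%:R^-1,
      enorm eps <= k.+1%:R^-1 * mu &
      2^-1 * dot (G *m v) v + mu * dot eta v + mu * (c * enorm (v - P *m v))
        <= dot eps v /\ k.+1%:R * mu < enorm v].
  apply: contrapT => nk; apply: nB; exists k.+1%:R, k.+1%:R^-1.
  split; rewrite ?invr_gt0// => mu G eps v mu0 Gpsd GC eC h.
  rewrite leNgt; apply/negP => vmu; apply: nk.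
  by exists (mu, G, eps, v).
pose mu k := (f k).1.1.1; pose G k := (f k).1.1.2.
pose eps k := (f k).1.2; pose v k := (f k).2.
have {}fP k : [/\ 0 < mu k, psd (G k), opnorm (G k - Gt) <= k.+1%:R^-1,
      enorm (eps k) <= k.+1%:R^-1 * mu k &
      2^-1 * dot (G k *m v k) (v k) + mu k * dot eta (v k) +
        mu k * (c * enorm (v k - P *m v k))
        <= dot (eps k) (v k) /\ k.+1%:R * mu k < enorm (v k)].
  by have := fP k; rewrite /mu /G /eps /v; case: (f k) => [[[]]].
have Gpsd k : psd (G k) by have [] := fP k.
have harm := @cvg_harmonic R.
have Gcvg : opnorm (G k - Gt) @[k --> \oo] --> 0.
  apply: (@squeeze_cvgr _ _ _ _ (fun=> 0) (@harmonic R)) => //; last exact: cvg_cst.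
  by apply: nearW => k; rewrite opnorm_ge0/=; have [] := fP k.
have Gtpsd : psd Gt by exact: (psd_limit Gcvg Gpsd).
have k0 k : 0 < k.+1%:R :> R by [].
have v0 k : 0 < enorm (v k).
  by have [mu0 _ _ _ [_]] := fP k; apply: lt_trans; rewrite mulr_gt0.
pose n k := (enorm (v k))^-1 *: v k.
have vn k : v k = enorm (v k) *: n k.
  by rewrite scalerA mulfV ?scale1r// gt_eqF.
have n1 k : enorm (n k) = 1.
  by rewrite enormZ gtr0_norm ?invr_gt0// mulVf// gt_eqF.
(* Divide the inequality by [mu k * enorm (v k)]. The quadratic term acquires the factor
   [enorm (v k) / mu k], which exceeds [k.+1]. *)
have main k : 2^-1 * (k.+1%:R * dot (G k *m n k) (n k)) + dot eta (n k) +
    c * enorm (n k - P *m n k) <= k.+1%:R^-1.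
  have [mu0 _ _ ek [+ vk]] := fP k.
  have Gk0 := (Gpsd k).2; move: (vn k) (n1 k) (v0 k) vk.
  move: (n k) (enorm (v k)) => w N -> w1 N0 vk.
  rewrite -!scalemxAr -scalerBr !dotlin enormZ (gtr0_norm N0).
  have {Gk0} := Gk0 w; set a := dot (G k *m w) w; set b := dot eta w.
  set d := enorm (w - P *m w) => a0 h.
  have e1 : dot (eps k) w <= k.+1%:R^-1 * mu k.
    by rewrite (le_trans (dot_le _ _))// w1 mulr1.
  rewrite -(ler_pM2r mu0); apply: le_trans e1; rewrite -(ler_pM2l N0).
  apply: le_trans h.
  have : N * (k.+1%:R * mu k) * a <= N * N * a.
    by rewrite ler_wpM2r// ler_pM2l// ltW.
  by lra.
have [U UU oU] := eventually_ultra; have PU := @ultra_proper _ _ UU.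
have harmU : @harmonic R @ U --> (0 : R) by move=> A /harm/oU.
have [l nl] : exists l : 'cV[R]_p, n @ U --> l.
  by apply: (bounded_ultra_cvg (r := 1)); apply: filterE => k /=; rewrite n1.
have l1 : enorm l = 1.
  apply: (closed_cvg _ (@closed_eq R 1) _ _ (cvg_enorm nl)).
  exact: filterE n1.
have GU : opnorm (G k - Gt) @[k --> U] --> 0 by move=> A /Gcvg/oU.
(* All other terms of [main] are bounded, so the quadratic form at [n k] is at most
   [2 * (1 + enorm eta)] over [k.+1]. *)
have Gtl : Gt *m l = 0.
  apply: (psd_eq0 Gtpsd).
  have lim : dot (G k *m n k) (n k) - 2 * (1 + enorm eta) * harmonic k @[k --> U]
      --> dot (Gt *m l) l - 2 * (1 + enorm eta) * 0.
    apply: cvgB; first exact: (cvg_dot (cvg_opnorm_mulmx GU nl) nl).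
    by apply: cvgM harmU; exact: cvg_cst.
  suff : dot (Gt *m l) l - 2 * (1 + enorm eta) * 0 <= 0 by rewrite mulr0 subr0.
  apply: (closed_cvg _ (@closed_le R 0) _ _ lim); apply: filterE => k /=.
  have := main k; have := dot_ge eta (n k); rewrite n1 mulr1.
  have : 0 <= c * enorm (n k - P *m n k) by rewrite mulr_ge0 ?enorm_ge0 ?ltW.
  have k1 : k.+1%:R^-1 <= 1 :> R by rewrite invf_le1// ler1n.
  set a := dot (G k *m n k) _; rewrite /harmonic /= => h1 h2 h3.
  rewrite subr_le0 ler_pdivlMr//; move: k1 h1 h2 h3.
  by move: (k.+1%:R : R) => K; move: K^-1 => K' *; lra.
(* Now drop the quadratic term and pass to the limit: the inner product of [eta = Gt *m q] with [l]
   vanishes by symmetry of [Gt], leaving [c * enorm (l - P *m l) <= 0]. *)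
have Tl : T l.
  have lim : dot eta (n k) + c * enorm (n k - P *m n k) - harmonic k @[k --> U]
      --> dot eta l + c * enorm (l - P *m l) - 0.
    apply: cvgB => //; apply: cvgD; first exact: cvg_dot (cvg_cst eta) nl.
    apply: cvgM (cvg_cst c) _; apply: cvg_enorm; apply: cvgB => //.
    exact: cvg_mulmx.
  have : dot eta l + c * enorm (l - P *m l) - 0 <= 0.
    apply: (closed_cvg _ (@closed_le R 0) _ _ lim); apply: filterE => k /=.
    have := main k; have := (Gpsd k).2 (n k).
    move=> /(mulr_ge0 (ltW (k0 k))); rewrite /harmonic /=.
    by move: (k.+1%:R : R) => K; move: K^-1 => K' *; lra.
  rewrite (psd_dotC _ _ Gtpsd) Gtl dot0l add0r subr0 pmulr_rle0// => lP.
  have /enorm_eq0/eqP : enorm (l - P *m l) = 0.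
    by apply/eqP; rewrite eq_le lP enorm_ge0.
  by rewrite subr_eq0 => /eqP ->; exact: (PT l).1.
by move: l1; rewrite (Gt_inj Gtl Tl) enorm0 => /esym/eqP; rewrite oner_eq0.
Qed.

End Perturbation.

(** * Energy sublevels and critical points of the perturbed problem *)

Section Minimizers.
Variables (R : realType) (p : nat) (J : 'cV[R]_p -> R) (x0 q : 'cV[R]_p).
Variables (P Gt : 'M[R]_p) (c : R).
Implicit Types (u v w x y z eps : 'cV[R]_p) (G : 'M[R]_p).
Local Notation T := (model_space J x0).
Local Notation eta := (Gt *m q).
Hypotheses (cJ : convexE J) (PT : is_orth_proj T P) (Tq : T q) (c0 : 0 < c).
Hypothesis Gt_inj : forall v, Gt *m v = 0 -> T v -> v = 0.
Hypothesis sub_eta : subdiff J x0 eta.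
Hypothesis sub_ri : forall n, orth T n -> enorm n <= 1 ->
  subdiff J x0 (eta + c *: n).

(** Push [eta] by [c] along the unit normal component of [v]; the tangential part of [v] does not
    see this push. *)
Lemma subdiff_steepest v : exists2 zeta, subdiff J x0 zeta &
  dot zeta v = dot eta v + c * enorm (v - P *m v).
Proof.
have [vP|vP] := eqVneq (v - P *m v) 0.
  by exists eta => //; rewrite vP enorm0 mulr0 addr0.
have nv := enorm_gt0 vP; set n := v - P *m v in vP nv *.
have on : orth T n := (PT v).2.
exists (eta + c *: ((enorm n)^-1 *: n)).
  apply: sub_ri; first exact: orthZ.
  by rewrite enormZ gtr0_norm ?invr_gt0// mulVf// gt_eqF.
have -> : dot (eta + c *: ((enorm n)^-1 *: n)) v =
    dot eta v + c * ((enorm n)^-1 * dot n v) by rewrite !dotlin.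
congr (_ + c * _); rewrite -[v in LHS](subrK (P *m v)) -/n dotDr (on _ (PT v).1).
by rewrite addr0 -sqr_enorm expr2 mulrA mulVf ?mul1r// gt_eqF.
Qed.

Lemma subdiff_growth z g : subdiff J z g ->
  dot eta (z - x0) + c * enorm (z - x0 - P *m (z - x0)) <= dot g (z - x0).
Proof.
move=> zg; have [zeta x0zeta <-] := subdiff_steepest (z - x0).
by have := subdiff_monotone zg x0zeta; rewrite dotBl subr_ge0.
Qed.

(** This supplies the coercivity behind the existence of a minimiser, even though [G] may be
    singular: the subgradient inequality at [x0] for the steepest [zeta] yields the growth
    hypothesis. *)
Lemma energy_sublevel_bound : exists B C : R, [/\ 0 < B, 0 < C &
  forall mu G eps y, 0 < mu -> psd G -> opnorm (G - Gt) <= C ->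
    enorm eps <= C * mu ->
    mu * J y + 2^-1 * dot (G *m (y - x0)) (y - x0) - dot eps (y - x0)
      <= mu * J x0 ->
    enorm (y - x0) <= B * mu].
Proof.
have [B [C [B0 C0 BC]]] := growth_bound q PT c0 Gt_inj.
exists B, C; split => // mu G eps y mu0 Gpsd GC epsC h.
apply: (BC mu G eps) => //; have [zeta x0zeta zetaE] := subdiff_steepest (y - x0).
have := x0zeta y; rewrite zetaE -(ler_pM2l mu0).
by lra.
Qed.

Lemma critical_points_close d : 0 < d -> exists2 C : R, 0 < C &
  forall mu G eps z, 0 < mu -> mu <= C -> psd G -> opnorm (G - Gt) <= C ->
    enorm eps <= C * mu ->
    subdiff J z (mu^-1 *: (eps - G *m (z - x0))) ->
    enorm (z - x0) < d /\ enorm (mu^-1 *: (eps - G *m (z - x0)) - eta) < d.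
Proof.
move=> d0; have [B [C [B0 C0 BC]]] := growth_bound q PT c0 Gt_inj.
apply: contrapT => nC.
have harm := @cvg_harmonic R.
have k0 k : 0 < k.+1%:R^-1 :> R by rewrite invr_gt0.
have /choice[f fP] k : exists t : R * 'M[R]_p * 'cV[R]_p * 'cV[R]_p,
    let: (mu, G, eps, v) := t in
    [/\ 0 < mu <= k.+1%:R^-1, psd G, opnorm (G - Gt) <= k.+1%:R^-1,
      enorm eps <= k.+1%:R^-1 * mu &
      [/\ subdiff J (x0 + v) (mu^-1 *: (eps - G *m v)), enorm v <= B * mu &
      enorm v < d -> enorm (mu^-1 *: (eps - G *m v) - eta) < d -> False]].
  apply: contrapT => nk; apply: nC; exists (Num.min C k.+1%:R^-1).
    by rewrite lt_min C0 k0.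
  move=> mu G eps z mu0; rewrite !le_min => /andP[_ muk] Gpsd /andP[GC Gk].
  rewrite minr_pMl ?(ltW mu0)// le_min => /andP[epsC epsk] sub.
  apply: contrapT => nz; apply: nk; exists (mu, G, eps, z - x0).
  rewrite mu0 muk; split=> //; split; first by rewrite subrKC.
    apply: (BC mu G eps) => //.
    have := subdiff_growth sub; rewrite dotZl dotBl -(ler_pM2l mu0).
    rewrite mulrA mulfV ?gt_eqF// mul1r.
    by have := Gpsd.2 (z - x0); lra.
  by move=> ? ?; apply: nz.
pose mu k := (f k).1.1.1; pose G k := (f k).1.1.2.
pose eps k := (f k).1.2; pose v k := (f k).2.
pose g k := (mu k)^-1 *: (eps k - G k *m v k).
have {}fP k : [/\ 0 < mu k <= k.+1%:R^-1, psd (G k),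
      opnorm (G k - Gt) <= k.+1%:R^-1, enorm (eps k) <= k.+1%:R^-1 * mu k &
      [/\ subdiff J (x0 + v k) (g k), enorm (v k) <= B * mu k &
        enorm (v k) < d -> enorm (g k - eta) < d -> False]].
  by have := fP k; rewrite /g /mu /G /eps /v; case: (f k) => [[[]]].
have Gpsd k : psd (G k) by have [] := fP k.
have [U UU oU] := eventually_ultra; have PU := @ultra_proper _ _ UU.
have harmU : @harmonic R @ U --> (0 : R) by move=> A /harm/oU.
have squeeze (h : nat -> R) K : (forall k, 0 <= h k <= K * k.+1%:R^-1) ->
    h @ U --> (0 : R).
  move=> hK; apply: (@squeeze_cvgr _ _ _ _ (fun=> 0) (fun k => K * harmonic k)).
  - by apply: filterE => k; exact: hK.
  - exact: cvg_cst.
  - by rewrite -(mulr0 K); apply: cvgM harmU; exact: cvg_cst.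
have GU : opnorm (G k - Gt) @[k --> U] --> 0.
  apply: (squeeze _ 1) => k; rewrite mul1r opnorm_ge0/=.
  by have [] := fP k.
have Gtpsd : psd Gt by exact: (psd_limit GU Gpsd).
pose s k := (mu k)^-1 *: v k.
have muinv k : 0 < (mu k)^-1 by rewrite invr_gt0; have [/andP[]] := fP k.
have scaled k w K : enorm w <= K * mu k -> enorm ((mu k)^-1 *: w) <= K.
  have mu0 : 0 < mu k by rewrite -invr_gt0.
  by rewrite enormZ gtr0_norm// ler_pdivrMl// mulrC.
have [s' sU] : exists s' : 'cV[R]_p, s @ U --> s'.
  apply: (bounded_ultra_cvg (r := B)); apply: filterE => k /=.
  by apply: scaled; have [_ _ _ _ []] := fP k.
have vU : v @ U --> (0 : 'cV[R]_p).
  apply/cvg_enorm_dist; apply: (squeeze _ B) => k; rewrite subr0 enorm_ge0/=.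
  have [/andP[_ muk] _ _ _ [_ vB _]] := fP k.
  by rewrite (le_trans vB)// ler_pM2l.
have gE k : g k = (mu k)^-1 *: eps k - G k *m s k.
  by rewrite /g scalerBr scalemxAr.
(* The part [eps / mu] vanishes because [enorm (eps k)] is at most [mu k] times a null sequence. *)
have gU : g @ U --> - (Gt *m s').
  rewrite -[- _]add0r; rewrite (_ : g = fun k => (mu k)^-1 *: eps k - G k *m s k).
    apply: cvgB; last exact: cvg_opnorm_mulmx.
    apply/cvg_enorm_dist; apply: (squeeze _ 1) => k; rewrite subr0 enorm_ge0/=.
    by apply: scaled; rewrite mul1r; have [] := fP k.
  by apply/funext => k; exact: gE.
have x0U : x0 + v k @[k --> U] --> x0.
  by rewrite -[X in _ --> X]addr0; apply: cvgD vU; exact: cvg_cst.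
have subl : subdiff J x0 (- (Gt *m s')).
  apply: (subdiff_closed (convexE_continuous cJ) x0U gU); apply: filterE => k.
  by have [_ _ _ _ []] := fP k.
(* Both vectors are subgradients at [x0] and [q] lies in [T], which is orthogonal to their
   differences. *)
have orthq : dot (- (Gt *m s') - eta) q = 0.
  rewrite dotC; apply: Tq; exists (- (Gt *m s')), eta, 1.
  by rewrite scale1r.
have ge0 : 0 <= dot (- (Gt *m s') - eta) s'.
  have lim : dot (g k - eta) (s k) @[k --> U] --> dot (- (Gt *m s') - eta) s'.
    by apply: cvg_dot sU; apply: cvgB gU _; exact: cvg_cst.
  apply: (closed_cvg _ (@closed_ge R 0) _ _ lim); apply: filterE => k /=.
  have [_ _ _ _ [sub _ _]] := fP k.
  have := subdiff_growth sub; rewrite addrAC subrr add0r -subr_ge0 => h.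
  rewrite dotZr pmulr_rge0// dotBl (le_trans h)// opprD addrA lerBlDr lerDl.
  by rewrite mulr_ge0 ?enorm_ge0// ltW.
(* Adding [orthq] and [ge0] shows that the form of [Gt] is nonpositive at [s' + q], so [Gt] kills
   that vector. *)
have limE : - (Gt *m s') = eta.
  have : Gt *m (s' + q) = 0.
    apply: (psd_eq0 Gtpsd); move: orthq ge0.
    by rewrite mulmxDr !dotlin; lra.
  by rewrite mulmxDr => /eqP; rewrite addrC addr_eq0 => /eqP ->.
have small (h : nat -> 'cV[R]_p) : h @ U --> (0 : 'cV[R]_p) ->
    \forall k \near U, enorm (h k) < d.
  move=> hU; have : enorm (h k) @[k --> U] --> enorm (0 : 'cV[R]_p).
    exact: cvg_enorm.
  rewrite enorm0 => /cvgrPdist_lt/(_ _ d0).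
  by apply: filterS => k; rewrite sub0r normrN ger0_norm ?enorm_ge0.
have gU0 : g k - eta @[k --> U] --> (0 : 'cV[R]_p).
  by rewrite -(subrr eta) -{2}limE; apply: cvgB gU _; exact: cvg_cst.
have [k [vk gk]] := filter_ex (filterI (small _ vU) (small _ gU0)).
by have [_ _ _ _ [_ _]] := fP k; apply.
Qed.

End Minimizers.

(** * Fejer monotonicity and asymptotics of the Forward-Backward iterates *)

Section ForwardBackward.
Variables (R : realType) (p : nat) (J : 'cV[R]_p -> R) (G : 'M[R]_p).
Variables (mu tau : R) (u z xinit : 'cV[R]_p).
Hypotheses (cJ : convexE J) (J0 : forall x, 0 <= J x) (Gpsd : psd G).
Hypotheses (mu0 : 0 < mu) (tau0 : 0 < tau) (tauG : tau * opnorm G < 2).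
Hypothesis zcrit : subdiff J z (mu^-1 *: (u - G *m z)).
Implicit Types (x : 'cV[R]_p).

Local Notation step := (FB_step J mu u G tau).

Lemma FB_step_subdiff x :
  subdiff J (step x) ((tau * mu)^-1 *: (x + tau *: (u - G *m x) - step x)).
Proof. by apply: prox_subdiff => //; rewrite mulr_gt0. Qed.

(** Monotonicity between the new point and [z] makes the residual [a - tau *: (G *m a) - b] have
    nonnegative inner product with [b]. Expand the square of [a - tau *: (G *m a)] and bound its
    second-order term by [psd_sqr_le]. *)
Lemma FB_step_descent x (a := x - z) (b := step x - z) :
  enorm b ^+ 2 + tau * (2 - tau * opnorm G) * dot (G *m a) a +
    enorm (a - tau *: (G *m a) - b) ^+ 2 <= enorm a ^+ 2.
Proof.
have alg v w : 0 <= dot (v - tau *: (G *m v) - w) w ->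
    enorm w ^+ 2 + tau * (2 - tau * opnorm G) * dot (G *m v) v +
      enorm (v - tau *: (G *m v) - w) ^+ 2 <= enorm v ^+ 2.
  have := psd_sqr_le v Gpsd; rewrite -(ler_pM2l (exprn_gt0 2 tau0)).
  rewrite !sqr_enorm !dotlin (dotC w v) (dotC w (G *m v)) (dotC v (G *m v)).
  by lra.
apply: alg; have := subdiff_monotone (FB_step_subdiff x) zcrit; rewrite -/b.
rewrite (_ : (tau * mu)^-1 *: (x + tau *: (u - G *m x) - step x) -
    mu^-1 *: (u - G *m z) = (tau * mu)^-1 *: (a - tau *: (G *m a) - b)).
  by rewrite dotZl pmulr_rge0 ?invr_gt0 ?mulr_gt0.
have -> : mu^-1 = (tau * mu)^-1 * tau by field; rewrite !gt_eqF.
rewrite -scalerA -scalerBr; congr (_ *: _); rewrite /a /b mulmxBr.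
by apply/colP => i; rewrite !mxE; ring.
Qed.

Local Notation x_ k := (iter k step xinit).

Lemma FB_bounded k : enorm (x_ k - z) <= enorm (xinit - z).
Proof.
elim: k => //= k; apply: le_trans.
rewrite -(@ler_pXn2r _ 2%N) ?nnegrE ?enorm_ge0//.
apply: le_trans (FB_step_descent (x_ k)); rewrite -addrA lerDl.
by rewrite addr_ge0 ?sqr_ge0// mulr_ge0 ?(Gpsd.2)// mulr_ge0 ?(ltW tau0)// subr_ge0 ltW.
Qed.

(** The squared distances to [z] decrease and converge, so their increments tend to 0. By the
    descent inequality these control the form of [G] and the residual [r], and the successive
    difference is [r] plus [tau] times the gradient gap. *)
Lemma FB_vanishing : G *m (x_ k - z) @[k --> \oo] --> (0 : 'cV[R]_p) /\
  x_ k - x_ k.+1 @[k --> \oo] --> (0 : 'cV[R]_p).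
Proof.
pose d k := enorm (x_ k - z) ^+ 2.
pose s := tau * (2 - tau * opnorm G).
have s0 : 0 < s by rewrite mulr_gt0// subr_gt0.
pose e k := dot (G *m (x_ k - z)) (x_ k - z).
have e0 k : 0 <= e k by exact: Gpsd.2.
pose r k := x_ k - z - tau *: (G *m (x_ k - z)) - (x_ k.+1 - z).
have desc k : s * e k + enorm (r k) ^+ 2 <= d k - d k.+1.
  by rewrite lerBrDr addrC addrA; exact: FB_step_descent.
have d_decr : nonincreasing_seq d.
  apply/nonincreasing_seqP => k; rewrite -subr_ge0 (le_trans _ (desc k))//.
  by rewrite addr_ge0 ?sqr_ge0// mulr_ge0// ltW.
have d_cvg : cvgn d.
  apply: nonincreasing_is_cvgn => //; exists 0 => _ [k _ <-].
  exact: sqr_ge0.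
have dd : d k - d k.+1 @[k --> \oo] --> 0.
  rewrite -(subrr (limn d)); apply: cvgB => //.
  by rewrite (cvg_shiftS d).
have sqz (h : nat -> R) K : (forall k, 0 <= h k ^+ 2 <= K * (d k - d k.+1)) ->
    (forall k, 0 <= h k) -> h @ \oo --> (0 : R).
  move=> hK h0.
  have h2 : h k ^+ 2 @[k --> \oo] --> 0.
    apply: (@squeeze_cvgr _ _ _ _ (fun=> 0) (fun k => K * (d k - d k.+1))).
    - by apply: nearW => k; exact: hK.
    - exact: cvg_cst.
    - by rewrite -(mulr0 K); apply: cvgM dd; exact: cvg_cst.
  have -> : h = fun k => Num.sqrt (h k ^+ 2).
    by apply/funext => k; rewrite sqrtr_sqr ger0_norm.
  rewrite -(sqrtr0 R); apply: (cvg_comp _ _ h2); exact: sqrt_continuous.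
have Ge : G *m (x_ k - z) @[k --> \oo] --> (0 : 'cV[R]_p).
  apply/cvg_enorm_dist; apply: (sqz _ (opnorm G / s)) => k; rewrite subr0 ?enorm_ge0//.
  rewrite sqr_ge0/= (le_trans (psd_sqr_le _ Gpsd))// -mulrA ler_wpM2l ?opnorm_ge0//.
  rewrite ler_pdivlMl// (le_trans _ (desc k))// lerDl sqr_ge0//.
split=> //.
have rcvg : r @ \oo --> (0 : 'cV[R]_p).
  apply/cvg_enorm_dist; apply: (sqz _ 1) => k; rewrite subr0 ?enorm_ge0//.
  rewrite sqr_ge0/= mul1r (le_trans _ (desc k))// lerDr mulr_ge0 ?e0 ?ltW//.
have -> : (fun k => x_ k - x_ k.+1) = (fun k => r k + tau *: (G *m (x_ k - z))).
  by apply/funext => k; apply/colP => i; rewrite /r !mxE; ring.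
have Gz : tau *: (G *m (x_ k - z)) @[k --> \oo] --> tau *: (0 : 'cV[R]_p).
  by exact: cvgZ (cvg_cst tau) Ge.
have -> : (0 : 'cV[R]_p) = 0 + tau *: 0 by rewrite scaler0 addr0.
exact: cvgD rcvg Gz.
Qed.

(* It suffices to control the cluster points, all of which are critical. *)
Lemma FB_eventually (x' eta : 'cV[R]_p) (d : R) (M : set 'cV[R]_p) :
  (forall w, subdiff J w (mu^-1 *: (u - G *m w)) ->
    enorm (w - x') < d /\ enorm (mu^-1 *: (u - G *m w) - eta) < d) ->
  (forall w g, enorm (w - x') < d -> enorm (g - eta) < d -> subdiff J w g -> M w) ->
  \forall k \near \oo, M (x_ k).
Proof.
move=> close idM; have [Gvan xvan] := FB_vanishing.
apply: contrapT => nM.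
(* The index [j.+1] singles out outputs of a proximal step, which carry a subgradient; the starting
   point is arbitrary. *)
have /choice[f fP] k : exists j, (k <= j)%N /\ ~ M (x_ j.+1).
  apply: contrapT => nk; apply: nM; exists k.+1 => // -[//|j] /= kj.
  by apply: contrapT => nMj; apply: nk; exists j.
have foo : f @ \oo --> \oo.
  by move=> A [N _ NA]; exists N => // k /= Nk; apply: NA => /=; rewrite (leq_trans Nk)//; have [] := fP k.
have [U UU oU] := eventually_ultra; have PU := @ultra_proper _ _ UU.
have fU : f @ U --> \oo by move=> A /foo/oU.
have [w wU] : exists w : 'cV[R]_p, x_ (f k) @[k --> U] --> w.
  apply: (bounded_ultra_cvg (r := enorm (xinit - z) + enorm z)).
  apply: filterE => k /=; rewrite -[x_ _](subrK z) (le_trans (enormD _ _))//.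
  by rewrite lerD2r FB_bounded.
have GU : G *m (x_ (f k) - z) @[k --> U] --> (0 : 'cV[R]_p).
  exact: (@cvg_comp _ _ _ f (fun k => G *m (x_ k - z)) _ _ _ fU Gvan).
(* The limit [w] may differ from [z], but both have the same image under [G], so the limit of the
   proximal subgradients can be written in terms of [w]. *)
have Gw : G *m w = G *m z.
  have GwU : G *m (x_ (f k) - z) @[k --> U] --> G *m (w - z).
    by apply: cvg_mulmx; apply: cvgB wU _; exact: cvg_cst.
  have : G *m (w - z) = 0 by exact: (cvg_unique (@norm_hausdorff _ 'cV[R]_p) GwU GU).
  by rewrite mulmxBr => /eqP; rewrite subr_eq0 => /eqP.
pose g k := (tau * mu)^-1 *: (x_ k + tau *: (u - G *m x_ k) - x_ k.+1).
have gU : g (f k) @[k --> U] --> mu^-1 *: (u - G *m w).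
  have -> : mu^-1 *: (u - G *m w) =
      (tau * mu)^-1 *: (0 + tau *: (u - G *m z - 0)).
    rewrite add0r subr0 Gw scalerA; congr (_ *: _).
    by field; rewrite !gt_eqF.
  have -> : (fun k => g (f k)) = fun k => (tau * mu)^-1 *: ((x_ (f k) - x_ (f k).+1) +
      tau *: (u - G *m z - G *m (x_ (f k) - z))).
    apply/funext => k; rewrite /g /= mulmxBr; congr (_ *: _).
    by apply/colP => i; rewrite !mxE; ring.
  apply: cvgZ (cvg_cst _) _; apply: cvgD.
    exact: (@cvg_comp _ _ _ f (fun k => x_ k - x_ k.+1) _ _ _ fU xvan).
  by apply: cvgZ (cvg_cst _) _; apply: cvgB GU; exact: cvg_cst.
have wU' : x_ (f k).+1 @[k --> U] --> w.
  rewrite -[w]subr0.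
  have -> : (fun k => x_ (f k).+1) = fun k => x_ (f k) - (x_ (f k) - x_ (f k).+1).
    by apply/funext => k; rewrite subKr.
  apply: cvgB wU _.
  exact: (@cvg_comp _ _ _ f (fun k => x_ k - x_ k.+1) _ _ _ fU xvan).
have subg k : subdiff J (x_ (f k).+1) (g (f k)) by exact: FB_step_subdiff.
have subw : subdiff J w (mu^-1 *: (u - G *m w)).
  apply: (subdiff_closed (convexE_continuous cJ) wU' gU); exact: filterE.
have [wd gd] := close w subw.
have near_lt (h : nat -> 'cV[R]_p) (l l' : 'cV[R]_p) : h @ U --> l -> enorm (l - l') < d ->
    \forall k \near U, enorm (h k - l') < d.
  move=> hl ll'; have : enorm (h k - l') @[k --> U] --> enorm (l - l').
    by apply: cvg_enorm; apply: cvgB hl _; exact: cvg_cst.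
  by move/cvgr_lt; apply.
have [k [xk gk]] := filter_ex (filterI (near_lt _ _ _ wU' wd) (near_lt _ _ _ gU gd)).
by have [_ ] := fP k; apply; apply: idM xk gk (subg k).
Qed.

End ForwardBackward.

(** * Canonical parameters, the range of the pseudo-inverse and the step size *)

Section CanonicalParameters.
Variables (R : realType) (p : nat).
Implicit Types (x u v : 'cV[R]_p) (A P G : 'M[R]_p) (T : set 'cV[R]_p).

Lemma canonical_psd x mu u G : canonical_parameter x mu u G -> psd G.
Proof.
move=> [n [Phi [w [lambda [[n0 _] _ _ ->]]]]]; split=> [|v].
  by rewrite linearZ/= trmx_mul trmxK.
rewrite -scalemxAl dotZl mulr_ge0 ?invr_ge0//.
rewrite dotE trmx_mul trmx_mul trmxK -!mulmxA mulmxA -trmx_mul -dotE.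
exact: dot_ge0.
Qed.

(** Writing [X = X B X] with [B = P *m A *m P] and transposing the symmetric factor [X B] brings [P]
    to the front. The default value 0 of [pinv] also has its range in [T]. *)
Lemma pinv_range T P A v : is_orth_proj T P ->
  T (Defs.pinv (P *m A *m P) *m v).
Proof.
move=> PT; have Ps := is_orth_proj_sym PT.
rewrite /Defs.pinv; case: xgetP => [X _ [_ XAX _ XA]|_].
  rewrite (_ : X = P *m (A^T *m P *m X^T *m X)); last first.
    by rewrite -{1}XAX -XA !trmx_mul Ps !mulmxA.
  by rewrite -mulmxA; exact: (PT _).1.
by rewrite mul0mx -(mulmx0 _ P); exact: (PT 0).1.
Qed.

(** When the norm is 0 the extended quotient is infinite and puts no bound on [tau], but the product
    is then 0. *)
Lemma lt_div_opnorm A (tau : R) :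
  (tau%:E < 2%:E / (opnorm A)%:E)%E -> tau * opnorm A < 2.
Proof.
have [->|A0] := eqVneq (opnorm A) 0; first by rewrite mulr0.
have Apos : 0 < opnorm A by rewrite lt_neqAle eq_sym A0 opnorm_ge0.
by rewrite inver (negbTE A0) -EFinM lte_fin ltr_pdivlMr.
Qed.

End CanonicalParameters.

(** * Combining localisation, identification and the algorithm *)

Theorem theorem3 (R : realType) (p : nat) (x0 : 'cV[R]_p) (J : 'cV[R]_p -> R)
    (M : set 'cV[R]_p) (Gt : 'M[R]_p) :
  (forall x, 0 <= J x) ->
  @convex_function R 'cV[R]_p setT J ->
  M x0 ->
  locally_partly_smooth J M x0 ->
  [set v | Gt *m v = 0] `&` model_space J x0 = [set 0] ->
  ri (subdiff J x0) (precertificate J x0 Gt) ->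
  exists2 C : R, 0 < C &
    forall (mu : R) (u : 'cV[R]_p) (Gamma : 'M[R]_p),
      canonical_parameter x0 mu u Gamma -> 0 < mu ->
      let eps := u - Gamma *m x0 in
      Num.max (opnorm (Gamma - Gt)) (Num.max (enorm eps * mu^-1) mu) <= C ->
      forall (xinit : 'cV[R]_p) (tau : R),
        0 < tau -> (tau%:E < 2%:E / (opnorm Gamma)%:E)%E ->
        \forall k \near \oo, M (iter k (FB_step J mu u Gamma tau) xinit).
Proof.
move=> J0 /convex_functionE cJ Mx0 [_ [U /nbhs_singleton Ux0 psm]] kerT.
have [_ _ _ TM cJM] := psm x0 Mx0 Ux0.
have [P /orth_projP PT] := tangent_space_projection TM.
rewrite /precertificate; set Q := orth_proj _ in PT *; rewrite -mulmxA.
set q := (X in Gt *m X) => riq.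
have Tq : model_space J x0 q by exact: pinv_range.
have Gt_inj v : Gt *m v = 0 -> model_space J x0 v -> v = 0.
  by move=> Gtv Tv; have : [set 0] v by rewrite -kerT.
have [d d0 idM] := identification Mx0 TM cJM riq.
have sub_eta : subdiff J x0 (Gt *m q) by case: riq.
have [c c0 sub_ri] := ri_direction riq.
have [B [C1 [B0 C10 level]]] := energy_sublevel_bound PT c0 Gt_inj sub_eta sub_ri.
have [C2 C20 close] := critical_points_close cJ PT Tq c0 Gt_inj sub_eta sub_ri d0.
(* [C1] guarantees that a minimiser exists, [C2] that all critical points fall within the
   identification radius [d]. *)
exists (Num.min C1 C2); first by rewrite lt_min C10.
move=> mu u G /canonical_psd Gpsd mu0; set eps := u - G *m x0.
rewrite !ge_max !le_min ler_pdivrMr// ler_pdivrMr//.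
move=> /and3P[/andP[GC1 GC2] /andP[eC1 eC2] /andP[_ muC2]] xinit tau tau0.
move=> /lt_div_opnorm tauG.
have critE z : eps - G *m (z - x0) = u - G *m z.
  by rewrite /eps mulmxBr opprB addrA subrK.
have [||y yB|z zmin] := @min_exists _ _
    (fun y => mu * J y + (2^-1 * dot (G *m y) y - dot u y)) x0 (B * mu).
- move=> y; have Fy := nbhs_filter y.
  apply: (@cvgD _ R^o _ _ Fy); last exact: continuous_quadratic.
  by apply: (@cvgM _ _ _ Fy) (cvg_cst _) _; exact: convexE_continuous.
- by rewrite mulr_ge0 ?ltW.
- apply: (level mu G eps) => //; move: yB.
  (* Recentring at [x0] turns the linear term into [eps] up to an additive constant, which matches
     the energy in [level]. *)
  have -> : u = eps + G *m x0 by rewrite /eps subrK.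
  have [v ->] : exists v, y = x0 + v by exists (y - x0); rewrite subrKC.
  rewrite (_ : x0 + v - x0 = v); last by rewrite addrAC subrr add0r.
  by rewrite mulmxDr !dotlin (psd_dotC v x0 Gpsd); lra.
have zcrit : subdiff J z (mu^-1 *: (u - G *m z)).
  by apply: subdiff_of_min => // y; rewrite -!addrA; exact: zmin.
apply: (FB_eventually xinit cJ J0 Gpsd mu0 tau0 tauG zcrit _ idM).
by move=> w wcrit; rewrite -critE; apply: (close mu G eps); rewrite ?critE.
Qed.
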